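(* Let $\Gamma$ be a countable, locally finite group, and let $\{e\}=\Gamma_0\subseteq\Gamma_1\subseteq\Gamma_2\subseteq\cdots$ be an increasing sequence of finite subgroups of $\Gamma$ with $\Gamma=\bigcup_{n=0}^\infty\Gamma_n$. Define $k_n=|\Gamma_n|$, \[ H_\Gamma^{(n)}=\left\{ (m_1,m_2,\ldots)\in\ell^\infty(\mathbb{N},\mathbb{Z}):\sum_{i=jk_n+1}^{(j+1)k_n}m_i=0\;\text{for all}\;j=0,1,2,\ldots \right\},\qquad H_\Gamma=\bigcup_{n=0}^\infty H_\Gamma^{(n)}. \] Then for every $p\in[1,\infty)$, \[ (K_0(B^p_u(\Gamma)),K_0(B^p_u(\Gamma))^+,[1]_0)\cong(\ell^\infty(\mathbb{N},\mathbb{Z})/H_\Gamma,\ell^\infty(\mathbb{N},\mathbb{Z})^+/H_\Gamma,[\mathbf{1}]), \] where $\mathbf{1}$ denotes the constant sequence with value $1$. In particular, the ordered $K_0$ group of $B^p_u(\Gamma)$ for a countable, locally finite group $\Gamma$ does not depend on $p$.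
   Context: A discrete group is locally finite if every finitely generated subgroup is finite. $\Gamma$ is equipped with a proper (balls are finite) left-invariant metric, e.g. $d(g,h)=\min\{n\in\{0,1,2,\ldots\}:g^{-1}h\in\Gamma_n\}$; such a metric is unique up to bijective coarse equivalence. For $T\in B(\ell^p(\Gamma))$ write $T_{xy}=(T\delta_y)(x)$ and $\mathrm{prop}(T)=\sup\{d(x,y):x,y\in\Gamma,\ T_{xy}\neq 0\}\in[0,\infty]$. The $\ell^p$ uniform Roe algebra $B^p_u(\Gamma)$ is the operator norm closure in $B(\ell^p(\Gamma))$ of the algebra of all bounded operators on $\ell^p(\Gamma)$ with finite propagation. $K_0(A)^+$ denotes the set of classes in $K_0(A)$ of idempotents in matrix algebras over the unital Banach algebra $A$, and $[1]_0$ is the class of the unit. $\ell^\infty(\mathbb{N},\mathbb{Z})$ is the group of bounded integer sequences indexed by $\{1,2,\ldots\}$, $[\mathbf{1}]$ is the class of $\mathbf{1}$ in $\ell^\infty(\mathbb{N},\mathbb{Z})/H_\Gamma$, and $\ell^\infty(\mathbb{N},\mathbb{Z})^+/H_\Gamma$ is the collection of all elements of $\ell^\infty(\mathbb{N},\mathbb{Z})/H_\Gamma$ that can be represented by positive (i.e. entrywise nonnegative) sequences. An isomorphism of triples is a group isomorphism carrying positive cone onto positive cone and distinguished element to distinguished element.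
   Formalization: The isomorphism with the triple of ℓ^∞(N,Z)/H_Γ is stated for infinite Γ only: for finite Γ it fails, as K_0 is Z while ℓ^∞(N,Z)/H_Γ is uncountable; independence of p is stated for every countable, locally finite Γ. *)

(* Defs.v *)
From HB Require Import structures.
From mathcomp Require Import all_boot all_order all_algebra finmap.
From mathcomp Require Import boolp classical_sets functions cardinality fsbigop.
From mathcomp Require Import reals constructive_ereal ereal esum exp.
From mathcomp Require Import complex ring lra.

Set Implicit Arguments.
Unset Strict Implicit.
Unset Printing Implicit Defensive.

Import Order.TTheory GRing.Theory Num.Theory.
Local Open Scope classical_set_scope.
Local Open Scope ring_scope.

Local Notation normc := ComplexField.Normc.normc.

Lemma normc_ge0 (R : rcfType) (z : R[i]) : 0 <= normc z.
Proof. by case: z => a b; exact: sqrtr_ge0. Qed.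

(* The complex Banach space ell^p(T), for a real exponent p with p1 : 1 <= p.
   The proof p1 is an argument of the types built below; scalars are R[i], and
   psum p f is the sum of the |f x|^p over T. *)
Section ell_p.
Context {R : realType} {T : choiceType} {p : R} (p1 : 1 <= p).
Local Notation C := (R[i]^o).

Let p0 : 0 < p. Proof. exact: lt_le_trans ltr01 p1. Qed.

Definition psum (f : T -> C) : \bar R :=
  (\esum_(x in [set: T]) ((normc (f x)) `^ p)%:E)%E.

Definition ell_pred of 1 <= p : {pred T -> C} := fun f => `[< (psum f < +oo)%E >].

Lemma psum_ge0 f : (0 <= psum f)%E.
Proof. by apply: esum_ge0 => x _; rewrite lee_fin powR_ge0. Qed.

Lemma esumZ (I : choiceType) (a : R) (F : I -> R) : 0 <= a ->
  (forall x, 0 <= F x) ->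
  (\esum_(x in [set: I]) (a * F x)%:E <= a%:E * \esum_(x in [set: I]) (F x)%:E)%E.
Proof.
move=> a0 F0; apply: ge_ereal_sup => _ [X [finX _] <-].
have -> : (\sum_(x \in X) (a * F x)%:E = a%:E * \sum_(x \in X) (F x)%:E)%E.
  by rewrite ge0_mule_fsumr// => x; rewrite lee_fin.
apply: lee_wpmul2l; first by rewrite lee_fin.
by apply: esum_ge; exists X.
Qed.

Lemma psumD f g : (psum (f + g)%R <= (2 `^ p)%:E * (psum f + psum g))%E.
Proof.
rewrite /psum -esumD; try by move=> x _; rewrite lee_fin powR_ge0.
under [X in (_ <= _ * X)%E]eq_esum do rewrite -EFinD.
apply: le_trans (esumZ _ _); [|exact: powR_ge0|by move=> x; rewrite addr_ge0 ?powR_ge0].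
apply: le_esum => x _; rewrite lee_fin.
set a := normc (f x); set b := normc (g x).
have a0 : 0 <= a by exact: normc_ge0.
have b0 : 0 <= b by exact: normc_ge0.
apply: (@le_trans _ _ ((2 * Num.max a b) `^ p)).
  apply: ge0_ler_powR; rewrite ?nnegrE ?normc_ge0 ?mulr_ge0 ?le_max ?a0 ?(ltW p0)//.
  apply: le_trans (le_normcD _ _) _.
  by rewrite mulr2n mulrDl mul1r lerD// le_max lexx ?orbT.
rewrite powRM ?le_max ?a0// ler_wpM2l ?powR_ge0//.
by case: (leP a b) => _; rewrite ?lerDl ?lerDr powR_ge0.
Qed.

Lemma psumZ c f : (psum (c *: f)%R <= (normc c `^ p)%:E * psum f)%E.
Proof.
apply: le_trans (esumZ _ _); [|exact: powR_ge0|by move=> x; exact: powR_ge0].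
apply: le_esum => x _; rewrite lee_fin.
rewrite (_ : (c *: f) x = c * f x)// ComplexField.Normc.normcM.
by rewrite powRM ?normc_ge0.
Qed.

Lemma psum0 : psum 0 = 0%E.
Proof.
by apply: esum1 => x _; rewrite ComplexField.Normc.normc0 powR0// gt_eqF.
Qed.

Fact ell_pred_closed : subsemimod_closed (ell_pred p1).
Proof.
split; first split.
- by apply/asboolP; rewrite psum0 ltry.
- move=> f g /asboolP hf /asboolP hg; apply/asboolP.
  apply: le_lt_trans (psumD f g) _.
  rewrite lte_mul_pinfty ?lee_fin ?powR_ge0//.
  exact: lte_add_pinfty.
- move=> c f /asboolP hf; apply/asboolP.
  apply: le_lt_trans (psumZ c f) _.
  by rewrite lte_mul_pinfty ?lee_fin ?powR_ge0.
Qed.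
HB.instance Definition _ :=
  GRing.isSubmodClosed.Build R[i] (T -> C) (ell_pred p1) ell_pred_closed.

Record ell := Ell { ell_val :> T -> C; _ : ell_val \in ell_pred p1 }.
HB.instance Definition _ := [isSub for ell_val].
HB.instance Definition _ := [Choice of ell by <:].
HB.instance Definition _ := [SubChoice_isSubLmodule of ell by <:].

Definition ell_norm (f : ell) : R := fine (psum f) `^ p^-1.

End ell_p.
Arguments psum {R T} p f.
Arguments ell_pred {R} T {p} p1.
Arguments ell {R} T {p} p1.

Section ell_norm_theory.
Context {R : realType} {T : choiceType} {p : R} {p1 : 1 <= p}.
Local Notation L := (ell T p1).

Let p0 : 0 < p. Proof. exact: lt_le_trans ltr01 p1. Qed.

Lemma psum_fin (f : L) : psum p f \is a fin_num.
Proof.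
by rewrite ge0_fin_numE ?psum_ge0//; case: f => f /= /asboolP.
Qed.

Lemma ell_norm_ge0 (f : L) : 0 <= ell_norm f.
Proof. exact: powR_ge0. Qed.

Lemma ell_norm0 : ell_norm (0 : L) = 0.
Proof.
by rewrite /ell_norm (psum0 p1)/= powR0// gt_eqF// invr_gt0.
Qed.

Lemma ell_normZ c (f : L) : ell_norm (c *: f) <= normc c * ell_norm f.
Proof.
have cp : normc c = (normc c `^ p) `^ p^-1.
  by rewrite -powRrM divff ?gt_eqF// powRr1// normc_ge0.
rewrite /ell_norm {1}cp -powRM ?powR_ge0 ?fine_ge0 ?psum_ge0//.
apply: ge0_ler_powR; rewrite ?nnegrE ?invr_ge0 ?mulr_ge0 ?powR_ge0 ?fine_ge0 ?psum_ge0 ?(ltW p0)//.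
have := @psumZ _ _ p c f.
rewrite -[psum p f]fineK ?psum_fin// -EFinM.
by rewrite -[psum p (_ *: _)](@fineK _ (psum p (c *: f)%R)) ?psum_fin// lee_fin.
Qed.

(* A crude triangle inequality, enough for the closure properties below. *)
Lemma ell_normD (f g : L) : ell_norm (f + g) <= 4 * (ell_norm f + ell_norm g).
Proof.
rewrite /ell_norm; set a := fine (psum p f); set b := fine (psum p g).
have a0 : 0 <= a by rewrite fine_ge0 ?psum_ge0.
have b0 : 0 <= b by rewrite fine_ge0 ?psum_ge0.
have m0 : 0 <= Num.max a b by rewrite le_max a0.
have pV0 : 0 <= p^-1 by rewrite invr_ge0 ltW.
apply: (@le_trans _ _ ((2 `^ p * (2 * Num.max a b)) `^ p^-1)).
  apply: ge0_ler_powR; rewrite ?nnegrE ?fine_ge0 ?psum_ge0//.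
    by rewrite mulr_ge0 ?powR_ge0// mulr_ge0.
  have := psumD p1 f g.
  rewrite -[psum p f]fineK ?psum_fin// -[psum p g]fineK ?psum_fin// -EFinD -EFinM.
  rewrite -[psum p (_ + _)](@fineK _ (psum p (f + g)%R)) ?psum_fin// lee_fin.
  move=> /le_trans; apply; rewrite ler_wpM2l ?powR_ge0//.
  by rewrite mulr2n mulrDl mul1r lerD// le_max lexx ?orbT.
rewrite powRM ?powR_ge0 ?mulr_ge0// -powRrM divff ?gt_eqF// powRr1//.
rewrite powRM// (_ : 4 = 2 * 2) -?mulrA; last by rewrite -natrM.
rewrite ler_wpM2l// ler_pM ?powR_ge0//.
  by apply: ler1_powR; rewrite ?ler1n// invf_le1.
clearbody a b; by case: (leP a b) => _; rewrite ?lerDl ?lerDr powR_ge0.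
Qed.

Lemma ell_normN (f : L) : ell_norm (- f) <= ell_norm f.
Proof.
have := ell_normZ (-1) f; rewrite scaleN1r => /le_trans; apply.
by rewrite normcN ComplexField.Normc.normc1 mul1r.
Qed.

Lemma ell_normB (f g : L) : ell_norm (f - g) <= 4 * (ell_norm f + ell_norm g).
Proof.
apply: le_trans (ell_normD f (- g)) _.
by apply: ler_wpM2l; [by []|exact: lerD (lexx _) (ell_normN g)].
Qed.

End ell_norm_theory.
(* Keeps unification from unfolding the norm. *)
#[local] Opaque ell_norm.

(* bop T p1 is the ring B(ell^p(T)), with composition as product. *)
Section bounded_operators.
Context {R : realType} (T : choiceType) {p : R} (p1 : 1 <= p).
Local Notation L := (ell T p1).

Definition bounded_operator (F : L -> L) : Prop :=
  linear F /\ exists M : R, forall f, ell_norm (F f) <= M * ell_norm f.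

Definition bop_pred : {pred L -> L} := fun F => `[< bounded_operator F >].

Lemma bounded_ge0 (F : L -> L) : bounded_operator F ->
  exists2 M : R, 0 <= M & forall f, ell_norm (F f) <= M * ell_norm f.
Proof.
case=> _ [M hM]; exists (Num.max 0 M); rewrite ?le_max ?lexx// => f.
apply: le_trans (hM f) _; rewrite ler_wpM2r ?ell_norm_ge0//.
by rewrite le_max lexx orbT.
Qed.

Fact bop_zmod_closed : zmod_closed bop_pred.
Proof.
split=> [|F G /asboolP hF /asboolP hG]; apply/asboolP.
  split=> [a f g|]; first by rewrite scaler0 addr0.
  by exists 0 => f; rewrite mul0r ell_norm0.
have [M M0 hM] := bounded_ge0 hF; have [N N0 hN] := bounded_ge0 hG.
case: hF hG => linF _ [linG _]; split=> [a f g|].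
  rewrite !fctE linF linG scalerBr opprD.
  by rewrite addrACA.
exists (4 * (M + N)) => f; rewrite !fctE.
apply: le_trans (ell_normB (F f) (G f)) _.
rewrite -mulrA [(M + N) * _]mulrDl.
by apply: ler_wpM2l; [by []|exact: lerD (hM f) (hN f)].
Qed.
HB.instance Definition _ := GRing.isZmodClosed.Build _ bop_pred bop_zmod_closed.

Record bop := Bop { bop_fun :> L -> L; _ : bop_fun \in bop_pred }.
HB.instance Definition _ := [isSub for bop_fun].
HB.instance Definition _ := [Choice of bop by <:].
HB.instance Definition _ := [SubChoice_isSubZmodule of bop by <:].

Lemma bopP (F : bop) : bounded_operator F.
Proof. by case: F => F /= /asboolP. Qed.

HB.instance Definition _ (F : bop) :=
  GRing.isLinear.Build R[i] L L _ F (proj1 (bopP F)).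

Fact bop1_subproof : (id : L -> L) \in bop_pred.
Proof. by apply/asboolP; split=> //; exists 1 => f; rewrite mul1r. Qed.
Definition bop1 : bop := Bop bop1_subproof.

Fact bopM_subproof (F G : bop) : (F \o G : L -> L) \in bop_pred.
Proof.
apply/asboolP; split=> [a f g|]; first by rewrite /= !linearP.
have [M M0 hM] := bounded_ge0 (bopP F); have [N N0 hN] := bounded_ge0 (bopP G).
exists (M * N) => f; apply: le_trans (hM _) _.
by rewrite -mulrA ler_wpM2l.
Qed.
Definition bopM (F G : bop) : bop := Bop (bopM_subproof F G).

Fact bopMA : associative bopM. Proof. by move=> F G H; apply: val_inj. Qed.
Fact bop1M : left_id bop1 bopM. Proof. by move=> F; apply: val_inj. Qed.
Fact bopM1 : right_id bop1 bopM. Proof. by move=> F; apply: val_inj. Qed.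
Fact bopMDl : left_distributive bopM +%R.
Proof. by move=> F G H; apply: val_inj. Qed.
Fact bopMDr : right_distributive bopM +%R.
Proof.
by move=> F G H; apply: val_inj; apply/funext => f; rewrite /= !fctE /= raddfD.
Qed.
HB.instance Definition _ :=
  GRing.Zmodule_isPzRing.Build bop bopMA bop1M bopM1 bopMDl bopMDr.

Definition opnorm (F : bop) : R :=
  sup [set ell_norm (F f) | f in [set f | ell_norm f <= 1]].

Lemma bopBE (F G : bop) f : (F - G) f = F f - G f. Proof. by []. Qed.

Lemma opnorm_le (F : bop) (M : R) : 0 <= M ->
  (forall f, ell_norm (F f) <= M * ell_norm f) -> opnorm F <= M.
Proof.
move=> M0 hM; apply: ge_sup.
  by exists (ell_norm (F 0)); exists 0 => //=; rewrite ell_norm0.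
move=> _ [f /= f1 <-]; apply: le_trans (hM f) _.
by rewrite -[leRHS]mulr1 ler_wpM2l.
Qed.

Lemma opnorm_ub (F : bop) f : ell_norm f <= 1 -> ell_norm (F f) <= opnorm F.
Proof.
move=> f1; apply: sup_ubound; last by exists f.
have [M M0 hM] := bounded_ge0 (bopP F).
exists M => _ [g /= g1 <-]; apply: le_trans (hM g) _.
by rewrite -[leRHS]mulr1 ler_wpM2l.
Qed.

Lemma opnorm_ge0 (F : bop) : 0 <= opnorm F.
Proof.
apply: le_trans (@opnorm_ub F 0 _); first exact: ell_norm_ge0.
by rewrite ell_norm0.
Qed.

Lemma normc_real (a : R) : normc (a%:C)%C = `|a|.
Proof. by rewrite /= expr0n/= addr0 sqrtr_sqr. Qed.

Lemma opnormP (F : bop) f : ell_norm (F f) <= opnorm F * ell_norm f.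
Proof.
have [f0|fn0] := eqVneq (ell_norm f) 0.
  have [M M0 hM] := bounded_ge0 (bopP F).
  by apply: le_trans (hM f) _; rewrite f0 !mulr0.
have f0 : 0 < ell_norm f by rewrite lt_neqAle eq_sym fn0 ell_norm_ge0.
have [c cE] : exists c : R[i], normc c = ell_norm f.
  by exists ((ell_norm f)%:C)%C; rewrite normc_real ger0_norm ?ell_norm_ge0.
have cn0 : c != 0.
  by apply: contra_neq fn0 => c0; rewrite -cE c0 ComplexField.Normc.normc0.
have -> : F f = c *: F (c^-1 *: f).
  by rewrite linearZ scalerA divff// scale1r.
apply: le_trans (ell_normZ c (F (c^-1 *: f))) _.
rewrite cE mulrC; apply: ler_wpM2r; first exact: ell_norm_ge0.
apply: opnorm_ub; apply: le_trans (ell_normZ c^-1 f) _.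
by rewrite ComplexField.Normc.normcV cE mulVf.
Qed.

Lemma opnormB (F G : bop) : opnorm (F - G) <= 4 * (opnorm F + opnorm G).
Proof.
apply: opnorm_le => [|f]; first by rewrite mulr_ge0// addr_ge0 ?opnorm_ge0.
rewrite bopBE; apply: le_trans (ell_normB (F f) (G f)) _.
rewrite -mulrA [(opnorm F + _) * _]mulrDl.
by apply: ler_wpM2l; [by []|exact: lerD (opnormP F f) (opnormP G f)].
Qed.

Lemma opnormM (F G : bop) : opnorm (F * G) <= opnorm F * opnorm G.
Proof.
apply: opnorm_le => [|f]; first by rewrite mulr_ge0 ?opnorm_ge0.
apply: le_trans (opnormP F (G f)) _.
by rewrite -mulrA; apply: ler_wpM2l; [exact: opnorm_ge0|exact: opnormP].
Qed.

Fact ell_delta_subproof (y : T) :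
  ((fun x => (x == y)%:R) : T -> R[i]^o) \in ell_pred T p1.
Proof.
apply/asboolP; rewrite /psum (_ : (\esum_(_ in _) _)%E = 1%:E) ?ltry//.
rewrite (esumID [set y]); last by move=> x _; rewrite lee_fin powR_ge0.
rewrite setTI esum_set1 ?lee_fin ?powR_ge0// eqxx ComplexField.Normc.normc1 powR1.
rewrite esum1 ?adde0// => x [_ /= /eqP/negPf ->].
rewrite ComplexField.Normc.normc0 powR0// gt_eqF//.
exact: lt_le_trans ltr01 p1.
Qed.
Definition ell_delta (y : T) : L := Ell (ell_delta_subproof y).

Definition matrix_entry (F : bop) (x y : T) : R[i] := F (ell_delta y) x.

End bounded_operators.

Section groups.
Context {G : groupType}.
Implicit Types (S H : set G).

Definition subgroup H : Prop :=
  [/\ H 1%g, (forall x y, H x -> H y -> H (x * y)%g) & forall x, H x -> H x^-1%g].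

Record finite_exhaustion (G_ : nat -> set G) : Prop := FiniteExhaustion {
  exhaustion0 : G_ 0%N = [set 1%g];
  exhaustion_subgroup : forall n, subgroup (G_ n);
  exhaustion_finite : forall n, finite_set (G_ n);
  exhaustion_incr : forall n, G_ n `<=` G_ n.+1;
  exhaustion_cover : \bigcup_n G_ n = [set: G] }.

Record proper_left_invariant_metric {R : realType} (d : G -> G -> R) : Prop :=
  ProperLeftInvariantMetric {
  metric_ge0 : forall x y, 0 <= d x y;
  metric_eq0 : forall x y, d x y = 0 <-> x = y;
  metric_sym : forall x y, d x y = d y x;
  metric_triangle : forall x y z, d x z <= d x y + d y z;
  metric_left_invariant : forall g x y, d (g * x)%g (g * y)%g = d x y;
  metric_proper : forall x r, finite_set [set y | d x y <= r] }.

End groups.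

Definition locally_finite (G : groupType) : Prop :=
  forall S : set G, finite_set S -> finite_set (smallest subgroup S).

Fact roe_estimateB {R : realType} (e : R) : 0 < e -> 4 * (e / 9 + e / 9) < e.
Proof. by move=> e0; lra. Qed.

Fact roe_estimateM {R : realType} (f s e : R) : 0 <= f -> 0 <= s -> 0 < e ->
  0 < 4 * f + 16 * (1 + s) + 1 /\
  4 * (f * e + e * (4 * (1 + s))) < e * (4 * f + 16 * (1 + s) + 1).
Proof. by move=> f0 s0 e0; split; lra. Qed.

Section uniform_roe_algebra.
Context {R : realType} {G : groupType} {p : R} (p1 : 1 <= p).
Context {d : G -> G -> R} (dP : proper_left_invariant_metric d).
Local Notation B := (bop G p1).
Implicit Types F S : B.

(* 0 is added so that the zero operator has propagation 0: ereal_sup set0 = -oo. *)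
Definition propagation F : \bar R :=
  ereal_sup ([set 0%E] `|`
    [set (d u.1 u.2)%:E | u in [set u : G * G | matrix_entry F u.1 u.2 != 0]]).

Definition finite_propagation F : Prop := (propagation F < +oo)%E.

Lemma finite_propagationP F : finite_propagation F <->
  exists r : R, forall x y, matrix_entry F x y != 0 -> d x y <= r.
Proof.
split=> [Ffin|[r hr]].
  have F0 : (0 <= propagation F)%E by apply: ereal_sup_ubound; left.
  exists (fine (propagation F)) => x y Fxy.
  rewrite -lee_fin fineK ?ge0_fin_numE//.
  by apply: ereal_sup_ubound; right; exists (x, y).
apply: (@le_lt_trans _ _ (Num.max 0 r)%:E); last exact: ltry.
apply: ge_ereal_sup => _ [->|[[x y] /= Fxy <-]]; rewrite lee_fin le_max ?lexx//.
by rewrite hr ?orbT.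
Qed.

Lemma finite_propagation1 : finite_propagation 1.
Proof.
apply/finite_propagationP; exists 0 => x y.
rewrite /matrix_entry /= -[(_ == _)%:R]/((x == y)%:R).
have [->|_] := eqVneq x y; last by rewrite eqxx.
by rewrite (proj2 (metric_eq0 dP y y)).
Qed.

Lemma finite_propagationB F S :
  finite_propagation F -> finite_propagation S -> finite_propagation (F - S).
Proof.
move=> /finite_propagationP[r hr] /finite_propagationP[s hs].
apply/finite_propagationP; exists (Num.max r s) => x y FS0; rewrite le_max.
have [F0|/hr ->//] := eqVneq (matrix_entry F x y) 0.
have [S0|/hs ->] := eqVneq (matrix_entry S x y) 0; last by rewrite orbT.
have E : matrix_entry (F - S) x y = matrix_entry F x y - matrix_entry S x y by [].
by move: FS0; rewrite E F0 S0 subrr eqxx.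
Qed.

Lemma ell_sumE (I : Type) (r : seq I) (f : I -> ell G p1) x :
  (\sum_(i <- r) f i) x = \sum_(i <- r) f i x.
Proof. by elim/big_ind2 : _ => // f1 a1 f2 a2 <- <-. Qed.

Lemma ell_finite_support (A : set G) (f : ell G p1) : finite_set A ->
  (forall x, ~ A x -> f x = 0) ->
  f = \sum_(y <- fset_set A) (f y : R[i]) *: ell_delta p1 y.
Proof.
move=> finA fA; apply: val_inj; apply/funext => x.
rewrite [RHS]ell_sumE.
rewrite (eq_bigr (fun y => (f y : R[i]) * (x == y)%:R)); last by [].
have [Ax|/fA fx0] := pselect (A x).
  rewrite (big_fsetD1 x) /=; last by rewrite in_fset_set// inE.
  rewrite eqxx mulr1 big1_fset ?addr0// => y; rewrite !inE => /andP[yx _] _.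
  by rewrite eq_sym (negPf yx) mulr0.
rewrite [LHS]fx0 big1// => y _.
have [<-|] := eqVneq x y; last by rewrite mulr0.
by rewrite [f x]fx0 mul0r.
Qed.

Lemma finite_propagationM F S :
  finite_propagation F -> finite_propagation S -> finite_propagation (F * S).
Proof.
move=> /finite_propagationP[r hr] /finite_propagationP[s hs].
apply/finite_propagationP; exists (r + s) => x z.
apply: contraR; rewrite -ltNge => rsd.
pose A := [set y | d z y <= s].
have SA y : ~ A y -> S (ell_delta p1 z) y = 0.
  by move=> nA; apply/eqP; apply: contra_notT nA => /hs; rewrite /A/= (metric_sym dP).
rewrite -[matrix_entry _ _ _]/(F (S (ell_delta p1 z)) x).
rewrite (ell_finite_support (metric_proper dP z s) SA) raddf_sum ell_sumE.
apply/eqP; rewrite big_seq big1// => y; rewrite in_fset_set; last exact: (metric_proper dP).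
rewrite inE /= => dzy.
rewrite linearZ -[LHS]/(S (ell_delta p1 z) y * matrix_entry F x y).
have [->|/hr dxy] := eqVneq (matrix_entry F x y) 0; first by rewrite mulr0.
move: rsd; rewrite ltNge (le_trans (metric_triangle dP x y z))// lerD//.
by rewrite (metric_sym dP).
Qed.

(* The closure in operator norm of the operators of finite propagation; roe p1 dP
   is B^p_u(G) as a ring. The hypothesis dP is used to show that this closure is
   stable under products. *)
Definition roe_pred of proper_left_invariant_metric d : {pred B} := fun F =>
  `[< forall e : R, 0 < e -> exists2 S, finite_propagation S & opnorm (F - S) < e >].

Fact roe_subring_closed : subring_closed (roe_pred dP).
Proof.
split=> [|F S /asboolP hF /asboolP hS|F S /asboolP hF /asboolP hS]; apply/asboolP => e e0.
- exists 1; first exact: finite_propagation1.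
  by rewrite subrr (le_lt_trans _ e0)// opnorm_le// => f; rewrite mul0r ell_norm0.
- have e8 : 0 < e / 9 by rewrite divr_gt0.
  have [F' F'f FF'] := hF _ e8; have [S' S'f SS'] := hS _ e8.
  exists (F' - S'); first exact: finite_propagationB.
  have -> : F - S - (F' - S') = (F - F') - (S - S').
    by rewrite !opprD !opprK addrACA.
  apply: le_lt_trans (opnormB _ _) _.
  apply: (@le_lt_trans _ _ (4 * (e / 9 + e / 9))).
    by apply: ler_wpM2l; [by []|exact: lerD (ltW FF') (ltW SS')].
  exact: roe_estimateB.
- pose K := 4 * opnorm F + 16 * (1 + opnorm S) + 1.
  have F0 := opnorm_ge0 F; have S0 := opnorm_ge0 S.
  have K0 : 0 < K by case: (roe_estimateM F0 S0 e0).
  pose e' := Num.min 1 (e / K).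
  have e'0 : 0 < e' by rewrite lt_min ltr01 divr_gt0.
  have e'1 : e' <= 1 by rewrite ge_min lexx.
  have e'K : e' * K <= e by rewrite -ler_pdivlMr// ge_min lexx orbT.
  have [F' F'f /ltW FF'] := hF _ e'0; have [S' S'f /ltW SS'] := hS _ e'0.
  exists (F' * S'); first exact: finite_propagationM.
  have -> : F * S - F' * S' = F * (S - S') - (F - F') * ((S - S') - S).
    rewrite [S - S' - S]addrC addKr mulrBr mulrN mulrBl opprK.
    by rewrite addrA subrK.
  apply: le_lt_trans (opnormB _ _) _.
  have h1 : opnorm (F * (S - S')) <= opnorm F * e'.
    by apply: le_trans (opnormM _ _) _; apply: ler_wpM2l; [exact: F0|exact: SS'].
  have h2 : opnorm ((F - F') * ((S - S') - S)) <= e' * (4 * (1 + opnorm S)).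
    apply: le_trans (opnormM _ _) _; apply: ler_pM; [exact: opnorm_ge0|exact: opnorm_ge0|exact: FF'|].
    apply: le_trans (opnormB _ _) _; apply: ler_wpM2l; first by [].
    by apply: lerD; [exact: le_trans SS' e'1|exact: lexx].
  apply: (@le_lt_trans _ _ (4 * (opnorm F * e' + e' * (4 * (1 + opnorm S))))).
    by apply: ler_wpM2l; [by []|exact: lerD h1 h2].
  by apply: lt_le_trans e'K; case: (roe_estimateM F0 S0 e'0).
Qed.
HB.instance Definition _ := GRing.isSubringClosed.Build _ (roe_pred dP) roe_subring_closed.

Record roe := Roe { roe_val :> B; _ : roe_val \in roe_pred dP }.
HB.instance Definition _ := [isSub for roe_val].
HB.instance Definition _ := [Choice of roe by <:].
HB.instance Definition _ :=
  GRing.SubChoice_isSubPzRing.Build _ _ roe roe_subring_closed.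

End uniform_roe_algebra.

(* The Grothendieck group of a commutative monoid. *)
Section grothendieck_group.
Variable M : nmodType.
Local Open Scope quotient_scope.
Implicit Types a b : M * M.

Definition groth_eqv a b : bool :=
  `[< exists c, a.1 + b.2 + c = b.1 + a.2 + c >].

Lemma groth_eqvP a b :
  reflect (exists c, a.1 + b.2 + c = b.1 + a.2 + c) (groth_eqv a b).
Proof. exact: asboolP. Qed.

Fact groth_eqv_is_equiv : equiv_class_of groth_eqv.
Proof.
split=> [a|a b|b a c].
- by apply/groth_eqvP; exists 0.
- by apply/groth_eqvP/groth_eqvP => -[c E]; exists c.
- move=> /groth_eqvP[u U] /groth_eqvP[v V]; apply/groth_eqvP.
  exists (b.1 + b.2 + u + v).
  rewrite [LHS](AC (2*4) ((1*4*5)*(3*2*6)))/= U V.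
  by rewrite [LHS](AC (3*3) ((4*2)*(1*5*3*6))).
Qed.

Canonical groth_equiv := EquivRelPack groth_eqv_is_equiv.
Canonical groth_encModRel := defaultEncModRel groth_eqv.

Definition groth := {eq_quot groth_eqv}.
HB.instance Definition _ : EqQuotient (M * M)%type groth_eqv groth :=
  EqQuotient.on groth.
HB.instance Definition _ := Choice.on groth.

Definition groth0 : groth := lift_cst groth (0 : M, 0 : M).
Definition groth_add :=
  lift_op2 groth (fun a b => (a.1 + b.1, a.2 + b.2)).
Definition groth_opp := lift_op1 groth (fun a => (a.2, a.1)).

Canonical pi_groth0 := PiConst groth0.

Lemma pi_groth_opp : {morph \pi : a / (a.2, a.1) >-> groth_opp a}.
Proof.
move=> a; unlock groth_opp; apply/eqP; rewrite piE; apply/groth_eqvP => /=.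
have /eqP : repr (\pi_groth a) == a %[mod groth] by rewrite reprK.
move=> /eqmodP/groth_eqvP[c E]; exists c.
by rewrite [a.2 + _]addrC E [a.1 + _]addrC.
Qed.
Canonical pi_groth_opp_morph := PiMorph1 pi_groth_opp.

Lemma pi_groth_add :
  {morph \pi : a b / (a.1 + b.1, a.2 + b.2) >-> groth_add a b}.
Proof.
move=> a b; unlock groth_add; apply/eqP; rewrite piE; apply/groth_eqvP => /=.
have /eqmodP/groth_eqvP[c E] : repr (\pi_groth a) = a %[mod groth] by rewrite reprK.
have /eqmodP/groth_eqvP[d F] : repr (\pi_groth b) = b %[mod groth] by rewrite reprK.
exists (c + d).
rewrite [LHS](AC (2*2*2) ((1*3*5)*(2*4*6)))/= -E -F.
by rewrite [LHS](AC (3*3) ((1*4)*(2*5)*(3*6))).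
Qed.
Canonical pi_groth_add_morph := PiMorph2 pi_groth_add.

Fact groth_addA : associative groth_add.
Proof.
by move=> x y z; rewrite -[x]reprK -[y]reprK -[z]reprK !piE /= !addrA.
Qed.

Fact groth_addC : commutative groth_add.
Proof.
by move=> x y; rewrite -[x]reprK -[y]reprK !piE /= addrC [X in (_, X)]addrC.
Qed.

Fact groth_add0 : left_id groth0 groth_add.
Proof. by move=> x; rewrite -[x]reprK !piE /= !add0r -surjective_pairing. Qed.

Fact groth_addN : left_inverse groth0 groth_opp groth_add.
Proof.
move=> x; rewrite -[x]reprK !piE /=; apply/eqmodP/groth_eqvP; exists 0 => /=.
by rewrite !addr0 add0r addrC.
Qed.

HB.instance Definition _ :=
  GRing.isZmodule.Build groth groth_addA groth_addC groth_add0 groth_addN.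

Definition groth_class (a : M) : groth := \pi_groth (a, 0).

End grothendieck_group.

(* K_0 of a unital ring A: the Grothendieck group of the monoid of (algebraic)
   Murray-von Neumann classes of idempotent matrices over A, e ~ f meaning that
   e = x y and f = y x for some rectangular x and y. The sum is e (+) f. *)
Section K_theory.
Variable A : pzRingType.
Local Open Scope quotient_scope.

Definition idempotent_pred : pred {n & 'M[A]_n} :=
  fun e => tagged e *m tagged e == tagged e.

Record idempotent :=
  Idempotent { idempotent_val :> {n & 'M[A]_n}; _ : idempotent_pred idempotent_val }.
HB.instance Definition _ := [isSub for idempotent_val].
HB.instance Definition _ := [Choice of idempotent by <:].
Implicit Types e f g : idempotent.

Lemma idempotentP e : tagged e *m tagged e = tagged e.
Proof. by case: e => e /= /eqP. Qed.

Definition mvn_eqv e f : bool :=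
  `[< exists x : 'M[A]_(tag e, tag f), exists y : 'M[A]_(tag f, tag e),
      x *m y = tagged e /\ y *m x = tagged f >].

Lemma mvn_eqvP e f :
  reflect (exists x : 'M[A]_(tag e, tag f), exists y : 'M[A]_(tag f, tag e),
    x *m y = tagged e /\ y *m x = tagged f) (mvn_eqv e f).
Proof. exact: asboolP. Qed.

Fact mvn_eqv_is_equiv : equiv_class_of mvn_eqv.
Proof.
split=> [e|e f|f e g].
- by apply/mvn_eqvP; exists (tagged e), (tagged e); rewrite idempotentP.
- by apply/mvn_eqvP/mvn_eqvP => -[x [y [E F]]]; exists y, x.
- move=> /mvn_eqvP[x [y [xy yx]]] /mvn_eqvP[z [t [zt tz]]].
  apply/mvn_eqvP; exists (x *m z), (t *m y); split.
    by rewrite mulmxA -(mulmxA x) zt -yx !mulmxA xy -mulmxA xy idempotentP.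
  by rewrite mulmxA -(mulmxA t) yx -zt !mulmxA tz -mulmxA tz idempotentP.
Qed.

Canonical mvn_equiv := EquivRelPack mvn_eqv_is_equiv.
Canonical mvn_encModRel := defaultEncModRel mvn_eqv.

Definition mvn_class := {eq_quot mvn_eqv}.
HB.instance Definition _ : EqQuotient idempotent mvn_eqv mvn_class :=
  EqQuotient.on mvn_class.
HB.instance Definition _ := Choice.on mvn_class.

Fact idempotent0_subproof :
  idempotent_pred (Tagged (fun n => 'M[A]_n) (0 : 'M[A]_0)).
Proof. by rewrite /idempotent_pred /= mulmx0. Qed.
Definition idempotent0 : idempotent := Idempotent idempotent0_subproof.

Fact idempotent1_subproof :
  idempotent_pred (Tagged (fun n => 'M[A]_n) (1%:M : 'M[A]_1)).
Proof. by rewrite /idempotent_pred /= mulmx1. Qed.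
Definition idempotent1 : idempotent := Idempotent idempotent1_subproof.

Fact idempotent_add_subproof e f :
  idempotent_pred (Tagged (fun n => 'M[A]_n) (block_mx (tagged e) 0 0 (tagged f))).
Proof.
by rewrite /idempotent_pred /= mulmx_block !(mulmx0, mul0mx) !(addr0, add0r)
  !idempotentP.
Qed.
Definition idempotent_add e f : idempotent :=
  Idempotent (idempotent_add_subproof e f).

Definition mvn0 : mvn_class := lift_cst mvn_class idempotent0.
Definition mvn_add := lift_op2 mvn_class idempotent_add.

Canonical pi_mvn0 := PiConst mvn0.

Lemma pi_mvn_add : {morph \pi : e f / idempotent_add e f >-> mvn_add e f}.
Proof.
move=> e f; unlock mvn_add; apply/eqmodP/mvn_eqvP => /=.
have /eqmodP/mvn_eqvP[x [y [xy yx]]] : e = repr (\pi_mvn_class e) %[mod mvn_class].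
  by rewrite reprK.
have /eqmodP/mvn_eqvP[z [t [zt tz]]] : f = repr (\pi_mvn_class f) %[mod mvn_class].
  by rewrite reprK.
exists (block_mx x 0 0 z), (block_mx y 0 0 t).
by rewrite !mulmx_block !(mulmx0, mul0mx) !(addr0, add0r) xy yx zt tz.
Qed.
Canonical pi_mvn_add_morph := PiMorph2 pi_mvn_add.

Lemma mvn_castmx e f (E : tag e = tag f) :
  castmx (E, E) (tagged e) = tagged f -> mvn_eqv e f.
Proof.
case: e f E => [[n e] eP] [[m f] fP] /= E; case: _ / E in f fP * => /= E.
apply/mvn_eqvP => /=; exists e, e.
by rewrite castmx_id in E; rewrite -E (eqP eP).
Qed.

Fact mvn_addA : associative mvn_add.
Proof.
move=> u v w; rewrite -[u]reprK -[v]reprK -[w]reprK !piE.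
move: (repr u) (repr v) (repr w) => e f g; apply/esym/eqmodP.
apply: (@mvn_castmx (idempotent_add (idempotent_add e f) g)
  (idempotent_add e (idempotent_add f g)) (esym (addnA _ _ _))) => /=.
have := @block_mxA A _ _ _ _ _ _ (tagged e) 0 0 0 (tagged f) 0 0 0 (tagged g).
rewrite /= !row_mx0 !col_mx0 => ->.
exact: eq_castmx.
Qed.

Fact mvn_addC : commutative mvn_add.
Proof.
move=> u v; rewrite -[u]reprK -[v]reprK !piE.
move: (repr u) (repr v) => e f; apply/eqmodP/mvn_eqvP => /=.
exists (block_mx 0 (tagged e) (tagged f) 0), (block_mx 0 (tagged f) (tagged e) 0).
by rewrite !mulmx_block !(mulmx0, mul0mx) !(addr0, add0r) !idempotentP.
Qed.

Fact mvn_add0 : left_id mvn0 mvn_add.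
Proof.
move=> u; rewrite -[u]reprK !piE; move: (repr u) => e; apply/eqmodP/mvn_eqvP => /=.
exists (col_mx 0 (tagged e)), (row_mx 0 (tagged e)).
by rewrite mul_col_row mul_row_col !(mulmx0, mul0mx) add0r idempotentP.
Qed.

HB.instance Definition _ :=
  GRing.isNmodule.Build mvn_class mvn_addA mvn_addC mvn_add0.

Definition K0 : zmodType := groth mvn_class.

Definition K0_class e : K0 := groth_class (\pi_mvn_class e).

Definition K0_pos : set K0 := range K0_class.

Definition K0_one : K0 := K0_class idempotent1.

End K_theory.

(* Bounded integer sequences m_1, m_2, ...; m_i is stored at index i - 1, so the
   block jk + 1 <= i <= (j + 1)k becomes jk <= i < (j + 1)k. *)
Definition linf_pred : {pred nat -> int} :=
  fun m => `[< exists M : int, forall i, `|m i| <= M >].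

Fact linf_zmod_closed : zmod_closed linf_pred.
Proof.
split=> [|m n /asboolP[M hM] /asboolP[N hN]]; apply/asboolP.
  by exists 0 => i; rewrite normr0.
by exists (M + N) => i; apply: le_trans (ler_normB _ _) _; exact: lerD.
Qed.
HB.instance Definition _ := GRing.isZmodClosed.Build _ linf_pred linf_zmod_closed.

Record linf := Linf { linf_val :> nat -> int; _ : linf_val \in linf_pred }.
HB.instance Definition _ := [isSub for linf_val].
HB.instance Definition _ := [Choice of linf by <:].
HB.instance Definition _ := [SubChoice_isSubZmodule of linf by <:].

Fact linf1_subproof : (fun=> 1) \in linf_pred.
Proof. by apply/asboolP; exists 1 => i; rewrite normr1. Qed.
Definition linf1 : linf := Linf linf1_subproof.

Lemma card_fsetM (S T : choiceType) (A : {fset S}) (B : {fset T}) :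
  #|` (A `*` B)%fset| = (#|` A| * #|` B|)%N.
Proof.
rewrite -(size_allpairs pair); apply/perm_size/uniq_perm => //.
  by apply: allpairs_uniq => // -[x y] [z t].
move=> [x y]; rewrite [LHS]in_fsetM; apply/andP/allpairsP => [[xA yB]|].
  by exists (x, y).
by move=> [[z t] [/= zA tB [-> ->]]].
Qed.

(* H_pred is the subgroup H_G of linf; that it is one uses that each
   exhaustion_card n divides the next. *)
Section H_Gamma.
Context {G : groupType} (G_ : nat -> set G).

Definition exhaustion_card (n : nat) : nat := #|` fset_set (G_ n)|.
Local Notation k := exhaustion_card.

Definition H_n (n : nat) : set linf :=
  [set m | forall j : nat, \sum_(j * k n <= i < j.+1 * k n) m i = 0].

Definition H_pred of finite_exhaustion G_ : {pred linf} :=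
  fun m => `[< (\bigcup_n H_n n) m >].

Variable GE : finite_exhaustion G_.

Lemma subgroup_card_dvd (H K : set G) : subgroup H -> subgroup K ->
  finite_set K -> H `<=` K -> (#|` fset_set H| %| #|` fset_set K|)%N.
Proof.
move=> [H1 HM HV] [K1 KM KV] finK HK.
have finH : finite_set H by exact: sub_finite_set HK finK.
pose r x := xget 1%g [set y | K y /\ H (y^-1 * x)%g].
have rP x : K x -> K (r x) /\ H ((r x)^-1 * x)%g.
  move=> Kx; apply: (xgetPex 1%g (P := [set y | K y /\ H (y^-1 * x)%g])).
  by exists x; split; rewrite ?mulVg.
have rE x h : H h -> r (x * h)%g = r x.
  move=> Hh; congr xget; apply/seteqP; split=> y [Ky Hy]; split=> //.
    have := HM _ _ Hy (HV _ Hh).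
    by rewrite -!mulgA mulgV mulg1.
  by rewrite mulgA; exact: HM.
pose A := [set x | K x /\ r x = x].
have AK : A `<=` K by move=> x [].
have finA : finite_set A by exact: sub_finite_set AK finK.
have -> : fset_set K =
    [fset (u.1 * u.2)%g | u in (fset_set A `*` fset_set H)%fset]%fset.
  apply/fsetP => x; apply/idP/imfsetP => /= [|[[a h] /=]].
    rewrite in_fset_set// inE => Kx; have [Kr Hr] := rP x Kx.
    exists (r x, ((r x)^-1 * x)%g); last by rewrite /= mulVKg.
    rewrite in_fsetM /= !in_fset_set//; apply/andP; split; rewrite inE//.
    by split=> //; rewrite -[LHS](rE (r x) _ Hr) mulVKg.
  rewrite in_fsetM /= !in_fset_set// => /andP[]; rewrite !inE => -[Ka _] Hh ->.
  by apply: KM => //; exact: HK.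
rewrite card_in_imfset /=.
  by rewrite card_fsetM dvdn_mull.
have AHP (u : G * G) : u \in (fset_set A `*` fset_set H)%fset -> A u.1 /\ H u.2.
  by rewrite in_fsetM !in_fset_set// => /andP[]; rewrite !inE.
move=> [a h] [b g] /AHP[[_ ra] Hh] /AHP[[_ rb] Hg] /= E.
have ab : a = b by rewrite -[a]ra -(rE a h Hh) E rE.
by move: E; rewrite ab => /mulgI ->.
Qed.

Lemma exhaustion_card_dvd n m : (n <= m)%N -> (k n %| k m)%N.
Proof.
move=> /subnK <-; elim: (m - n)%N => [|l IH]; first by rewrite add0n.
rewrite addSn (dvdn_trans IH)// subgroup_card_dvd//.
- exact: (exhaustion_subgroup GE).
- exact: (exhaustion_subgroup GE).
- exact: (exhaustion_finite GE).
- exact: (exhaustion_incr GE).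
Qed.

Lemma H_n_incr n m : (n <= m)%N -> H_n n `<=` H_n m.
Proof.
move=> /exhaustion_card_dvd/dvdnP[q E] x hx j.
have blocks a l : \sum_(a * k n <= i < (a + l) * k n) x i = 0.
  elim: l => [|l IH]; first by rewrite addn0 big_geq.
  rewrite (big_cat_nat _ (n := ((a + l) * k n)%N)) ?leq_mul2r ?leq_addr ?orbT//=.
    by rewrite IH add0r addnS; exact: hx.
  by rewrite leq_add2l leqnSn orbT.
by rewrite E !mulnA mulSn addnC; exact: blocks.
Qed.

Fact H_zmod_closed : zmod_closed (H_pred GE).
Proof.
split=> [|x y /asboolP[n _ hx] /asboolP[m _ hy]]; apply/asboolP.
  by exists 0%N => // j; rewrite big1.
exists (maxn n m) => // j.
have hx' := H_n_incr (leq_maxl n m) hx; have hy' := H_n_incr (leq_maxr n m) hy.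
by rewrite (eq_bigr (fun i => x i - y i))// sumrB hx' hy' subr0.
Qed.
HB.instance Definition _ := GRing.isZmodClosed.Build _ (H_pred GE) H_zmod_closed.

Definition linf_quot : zmodType := {ideal_quot (H_pred GE)}.

Definition linf_quot_class (m : linf) : linf_quot :=
  (\pi_{ideal_quot (H_pred GE)} m)%qT.

Definition linf_quot_pos : set linf_quot :=
  [set linf_quot_class m | m in [set m : linf | forall i, 0 <= m i]].

End H_Gamma.

Arguments H_pred {G G_} GE.
Arguments linf_quot {G G_} GE.
Arguments linf_quot_class {G G_} GE m.
Arguments linf_quot_pos {G G_} GE.

(* Triples: an abelian group, its positive cone, a distinguished element. *)
Record triple := Triple {
  triple_group : zmodType;
  triple_pos : set triple_group;
  triple_unit : triple_group }.
Arguments triple_pos : clear implicits.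
Arguments triple_unit : clear implicits.

Definition triple_iso (S T : triple) : Prop :=
  exists f : {additive triple_group S -> triple_group T},
    [/\ bijective f, f @` triple_pos S = triple_pos T &
      f (triple_unit S) = triple_unit T].

Definition K0_triple (A : pzRingType) : triple := Triple (@K0_pos A) (@K0_one A).

Definition linf_triple (G : groupType) (G_ : nat -> set G)
    (GE : finite_exhaustion G_) : triple :=
  Triple (linf_quot_pos GE) (linf_quot_class GE linf1).

(* Main.v *)
Require Import Defs.
From HB Require Import structures.
From mathcomp Require Import all_boot all_order all_algebra finmap.
From mathcomp Require Import boolp classical_sets functions cardinality fsbigop.
From mathcomp Require Import reals ereal esum exp hoelder.
From mathcomp Require Import complex ring lra.

Set Implicit Arguments.
Unset Strict Implicit.
Unset Printing Implicit Defensive.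

Import Order.TTheory GRing.Theory Num.Theory.
Local Open Scope classical_set_scope.
Local Open Scope ring_scope.
Local Open Scope sesquilinear_scope.

Local Notation normc := ComplexField.Normc.normc.

(** The operators of finite propagation are the union of the increasing stages A_n, where
  A_n consists of the bounded operators that preserve every coset x (G_ n): a ball around
  the identity is finite, hence contained in some G_ n. As p is finite, an operator is
  determined by its matrix, and the entries of an operator in A_n can be prescribed at will
  as long as they are bounded and supported on pairs in the same coset ([kernel_op]). So
  A_n is a product of copies of one and the same finite matrix algebra over the complex
  numbers, restricted to bounded families, and this holds for every exponent p: p only
  enters in the equivalent norms on the blocks. This is why K_0 does not depend on p.

  The union of the A_n is dense, and every A_n is a closed subring of a complete normed
  ring. Hence K_0 is continuous along the filtration: every idempotent matrix is equivalent
  to one over some A_n ([idempotent_mvn_filtration]), and idempotents over A_n that become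
  equivalent in the closure are equivalent over some later A_k ([mvn_filtration]).

  An idempotent over A_n is a bounded family of complex idempotent matrices, one for each
  coset of G_ n, all of the same size. Gram-Schmidt factors each one through a coordinate
  projection of the same rank, with bounds on the factors that do not depend on the coset
  ([idempotent_factor]), so the factorisations assemble into bounded operators. Thus every
  idempotent is equivalent to the diagonal projection with m x ones at each x, for some
  bounded multiplicity m from G to the natural numbers, and over A_n the rank on each coset,
  read off from the trace, is a complete invariant. Together with the continuity of K_0 this
  says that two multiplicities give the same class exactly when, for some n, they have the
  same sum over every coset of G_ n ([multiplicity_classP]).

  This description of the monoid of classes of idempotents does not mention p, which gives
  the independence of p. It also gives the computation: an infinite G is listed as the
  sequence of its elements in such a way that, for all n at once, the blocks of length
  |G_ n| are the cosets of G_ n ([listing_block]). Carried along the listing, bounded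
  multiplicities are the nonnegative bounded sequences, and the equivalence above is
  congruence modulo H_G. Passing to the Grothendieck group is [K0_triple_iso]. *)

(** * Idempotents in complete normed rings *)

Section geometric.
Context {R : realType}.

Lemma geometric_small (c e : R) : 0 < e -> exists k, c / 2 ^+ k < e.
Proof.
move=> e0; exists (Num.bound (c / e)).
rewrite ltr_pdivrMr ?exprn_gt0// mulrC -ltr_pdivrMr//.
have [ce|ce] := lerP 0 (c / e); last by rewrite (lt_trans ce)// exprn_gt0.
apply: lt_trans (archi_boundP ce) _.
by rewrite -natrX ltr_nat ltn_expl.
Qed.

Lemma geometric_le0 (a c : R) : (forall k, a <= c / 2 ^+ k) -> a <= 0.
Proof.
move=> h; rewrite leNgt; apply/negP => a0.
by have [k] := geometric_small c a0; rewrite ltNge h.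
Qed.

End geometric.

(** Completeness is only asked of sequences with geometrically decreasing steps: these are
  the ones that occur, and the explicit rate passes to matrices entry by entry. *)
Record complete_ring_norm {R : realType} (A : pzRingType) (nu : A -> R) : Prop := {
  nu_ge0 : forall x, 0 <= nu x;
  nu_0 : nu 0 = 0;
  nu_eq0 : forall x, nu x = 0 -> x = 0;
  nu_B : forall x y, nu (x - y) <= nu x + nu y;
  nu_M : forall x y, nu (x * y) <= nu x * nu y;
  nu_complete : forall (u : nat -> A) (c : R),
    (forall k, nu (u k.+1 - u k) <= c / 2 ^+ k) ->
    exists l, forall k, nu (l - u k) <= 2 * c / 2 ^+ k }.

Record closed_subring {R : realType} (A : pzRingType) (nu : A -> R) (U : set A) : Prop := {
  closed_subring1 : U 1;
  closed_subringB : forall x y, U x -> U y -> U (x - y);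
  closed_subringM : forall x y, U x -> U y -> U (x * y);
  closed_subring_closed : forall x,
    (forall e, 0 < e -> exists2 y, U y & nu (x - y) < e) -> U x }.

Definition mx_in (A : Type) (U : set A) m n (X : 'M[A]_(m, n)) :=
  forall i j, U (X i j).

Section matrix_norm.
Context {R : realType} {A : pzRingType} {nu : A -> R}.
Context (nuP : complete_ring_norm nu).

Definition mnorm m n (X : 'M[A]_(m, n)) : R := \sum_i \sum_j nu (X i j).

Lemma mnorm_ge0 m n (X : 'M_(m, n)) : 0 <= mnorm X.
Proof. by rewrite !sumr_ge0// => i _; rewrite sumr_ge0// => j _; apply: nu_ge0 nuP _. Qed.

Lemma le_mnorm m n (X : 'M_(m, n)) i j : nu (X i j) <= mnorm X.
Proof.
rewrite /mnorm (bigD1 i)//= (bigD1 j)//= -addrA lerDl addr_ge0// sumr_ge0// => k _.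
  exact: nu_ge0 nuP _.
by rewrite sumr_ge0// => l _; apply: nu_ge0 nuP _.
Qed.

Lemma mnormB m n (X Y : 'M_(m, n)) : mnorm (X - Y) <= mnorm X + mnorm Y.
Proof.
rewrite /mnorm -big_split/= ler_sum// => i _; rewrite -big_split/= ler_sum// => j _.
by rewrite !mxE; apply: nu_B nuP _ _.
Qed.

Lemma mnorm0 m n : mnorm (0 : 'M_(m, n)) = 0.
Proof. by rewrite /mnorm !big1// => i _; rewrite big1// => j _; rewrite mxE (nu_0 nuP). Qed.

Lemma mnorm_eq0 m n (X : 'M_(m, n)) : mnorm X <= 0 -> X = 0.
Proof.
move=> X0; apply/matrixP => i j; rewrite mxE; apply: (nu_eq0 nuP).
apply/eqP; rewrite eq_le (nu_ge0 nuP) andbT.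
exact: le_trans (le_mnorm X i j) X0.
Qed.

Lemma mnormN m n (X : 'M_(m, n)) : mnorm (- X) <= mnorm X.
Proof. by rewrite -sub0r (le_trans (mnormB _ _))// mnorm0 add0r. Qed.

Lemma mnormD m n (X Y : 'M_(m, n)) : mnorm (X + Y) <= mnorm X + mnorm Y.
Proof. by rewrite -{1}[Y]opprK (le_trans (mnormB _ _))// lerD2l mnormN. Qed.

Lemma mnorm_distC m n (X Y : 'M_(m, n)) : mnorm (X - Y) = mnorm (Y - X).
Proof.
by apply/eqP; rewrite eq_le; apply/andP; split; rewrite -opprB mnormN.
Qed.

Lemma nu_sum (I : Type) (r : seq I) (F : I -> A) :
  nu (\sum_(i <- r) F i) <= \sum_(i <- r) nu (F i).
Proof.
elim/big_rec2 : _ => [|i y x _ h]; first by rewrite (nu_0 nuP).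
rewrite -[x]opprK (le_trans (nu_B nuP _ _))// lerD2l.
by rewrite -sub0r (le_trans (nu_B nuP _ _))// (nu_0 nuP) add0r.
Qed.

Lemma mnormM m n l (X : 'M_(m, n)) (Y : 'M_(n, l)) :
  mnorm (X *m Y) <= mnorm X * mnorm Y.
Proof.
rewrite /mnorm mulr_suml ler_sum// => i _.
apply: (@le_trans _ _ (\sum_j \sum_k nu (X i k) * nu (Y k j))).
  apply: ler_sum => j _; rewrite mxE (le_trans (nu_sum _ _))//.
  by apply: ler_sum => k _; apply: nu_M nuP _ _.
rewrite exchange_big mulr_suml/=; apply: ler_sum => k _.
rewrite -mulr_sumr ler_wpM2l ?(nu_ge0 nuP)//.
rewrite [leRHS](bigD1 k)//= lerDl sumr_ge0// => a _.
by rewrite sumr_ge0// => b _; apply: nu_ge0 nuP _.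
Qed.

(** The entrywise 1-norm makes matrices over a complete normed ring complete, at the price of
  a constant c' that depends on the size. *)
Lemma mnorm_limit (U : set A) (UP : closed_subring nu U) m n
    (u : nat -> 'M_(m, n)) (c : R) :
  (forall k, mx_in U (u k)) ->
  (forall k, mnorm (u k.+1 - u k) <= c / 2 ^+ k) ->
  exists l c', mx_in U l /\ forall k, mnorm (l - u k) <= c' / 2 ^+ k.
Proof.
move=> Uu hu.
have /fin_all_exists[l hl] : forall ij : 'I_m * 'I_n, exists a : A,
    forall k, nu (a - u k ij.1 ij.2) <= 2 * c / 2 ^+ k.
  move=> [i j] /=; apply: (nu_complete nuP) => k.
  by apply: le_trans (hu k); have := le_mnorm (u k.+1 - u k) i j; rewrite !mxE.
exists (\matrix_(i, j) l (i, j)), ((m * n)%:R * (2 * c)); split.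
  move=> i j; rewrite mxE; apply: (closed_subring_closed UP) => e e0.
  have [k hk] := geometric_small (2 * c) e0.
  by exists (u k i j); [exact: Uu|exact: le_lt_trans (hl (i, j) k) hk].
move=> k; rewrite /mnorm.
apply: (@le_trans _ _ (\sum_(i < m) \sum_(j < n) (2 * c / 2 ^+ k))).
  by apply: ler_sum => i _; apply: ler_sum => j _; rewrite !mxE; exact: hl (i, j) k.
by rewrite !sumr_const !card_ord -mulrnA -[leLHS]mulr_natl mulnC mulrA lexx.
Qed.

Section subring_matrices.
Context {U : set A} (UP : closed_subring nu U).

Lemma closed_subring0 : U 0.
Proof.
by rewrite -(subrr 1); exact: (closed_subringB UP (closed_subring1 UP) (closed_subring1 UP)).
Qed.

Lemma closed_subringD x y : U x -> U y -> U (x + y).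
Proof.
move=> Ux Uy; rewrite -[y]opprK; apply: (closed_subringB UP) => //.
by rewrite -sub0r; apply: (closed_subringB UP) => //; exact: closed_subring0.
Qed.

Lemma mx_inB m n (X Y : 'M_(m, n)) : mx_in U X -> mx_in U Y -> mx_in U (X - Y).
Proof. by move=> hX hY i j; rewrite !mxE; apply: (closed_subringB UP). Qed.

Lemma mx_inD m n (X Y : 'M_(m, n)) : mx_in U X -> mx_in U Y -> mx_in U (X + Y).
Proof. by move=> hX hY i j; rewrite !mxE; apply: closed_subringD. Qed.

Lemma mx_inM m n l (X : 'M_(m, n)) (Y : 'M_(n, l)) :
  mx_in U X -> mx_in U Y -> mx_in U (X *m Y).
Proof.
move=> hX hY i j; rewrite !mxE; elim/big_ind : _ => //.
- exact: closed_subring0.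
- exact: closed_subringD.
- by move=> k _; apply: (closed_subringM UP).
Qed.

Lemma mx_in1 n : mx_in U (1%:M : 'M_n).
Proof.
move=> i j; rewrite mxE; case: eqP => _; rewrite ?mulr1n ?mulr0n.
  exact: (closed_subring1 UP).
exact: closed_subring0.
Qed.

(** The sum s of the Neumann series of t is the limit of the iteration u := 1 + t u, which
  exhibits s as a fixed point commuting with t. *)
Lemma neumann n (t : 'M_n) : mx_in U t -> mnorm t <= 2^-1 ->
  exists s, [/\ mx_in U s, (1%:M - t) *m s = 1%:M & s *m (1%:M - t) = 1%:M].
Proof.
move=> Ut t2.
pose u := fix u k : 'M_n := if k is k'.+1 then 1%:M + t *m u k' else 1%:M.
have Uu k : mx_in U (u k).
  by elim: k => [|k IH] /=; [exact: mx_in1|exact: mx_inD (@mx_in1 n) (mx_inM Ut IH)].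
have ut k : t *m u k = u k *m t.
  by elim: k => [|k IH] /=; rewrite ?mulmx1 ?mul1mx// mulmxDr mulmxDl mulmx1 mul1mx {1}IH mulmxA.
have du k : mnorm (u k.+1 - u k) <= mnorm (u 1%N - u 0%N) / 2 ^+ k.
  elim: k => [|k IH]; first by rewrite expr0 divr1.
  have -> : u k.+2 - u k.+1 = t *m (u k.+1 - u k) by rewrite /= opprD addrACA subrr add0r mulmxBr.
  rewrite (le_trans (mnormM _ _))// exprS invfM mulrCA ler_pM ?mnorm_ge0//.
have [s [c [Us sP]]] := mnorm_limit UP Uu du.
have c0 : 0 <= c by have := le_trans (mnorm_ge0 _) (sP 0%N); rewrite expr0 divr1.
have tc k : mnorm t * (c / 2 ^+ k) <= c / 2 ^+ k.
  by rewrite ler_piMl ?divr_ge0 ?exprn_ge0// (le_trans t2)// invf_le1 ?ler1n.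
have s1 : s = 1%:M + t *m s.
  apply/eqP; rewrite -subr_eq0; apply/eqP/mnorm_eq0/(@geometric_le0 _ _ (2 * c)) => k.
  have -> : s - (1%:M + t *m s) = (s - u k.+1) - t *m (s - u k).
    by rewrite mulmxBr /= opprB !opprD !addrA subrK.
  apply: le_trans (mnormB _ _) _; rewrite -mulrA mulrDl mul1r lerD//.
    apply: le_trans (sP _) _; rewrite ler_wpM2l// lef_pV2 ?posrE ?exprn_gt0//.
    by rewrite ler_weXn2l ?ler1n.
  by apply: le_trans (mnormM _ _) _; apply: le_trans (ler_wpM2l (mnorm_ge0 _) (sP k)) _.
have st : t *m s = s *m t.
  apply/eqP; rewrite -subr_eq0; apply/eqP/mnorm_eq0/(@geometric_le0 _ _ (2 * c)) => k.
  have -> : t *m s - s *m t = t *m (s - u k) - (s - u k) *m t.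
    by rewrite mulmxBr mulmxBl ut opprB addrA subrK.
  apply: le_trans (mnormB _ _) _; rewrite -mulrA mulrDl mul1r lerD//.
    by apply: le_trans (mnormM _ _) _; apply: le_trans (ler_wpM2l (mnorm_ge0 _) (sP k)) _.
  by rewrite (le_trans (mnormM _ _))// mulrC; apply: le_trans (ler_wpM2l (mnorm_ge0 _) (sP k)) _.
exists s; split=> //; first by rewrite mulmxBl mul1mx {1}s1 addrK.
by rewrite mulmxBr mulmx1 -st {1}s1 addrK.
Qed.

(** If x y is close to e and y x is close to f then x has a right inverse in the corner of e
  and a left inverse in the corner of f, by Neumann series; they coincide, so x is an
  equivalence between e and f. Completeness of U keeps the inverse in U. *)
Lemma approx_mvn m n (e : 'M_m) (f : 'M_n) (x : 'M_(m, n)) (y : 'M_(n, m)) :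
  mx_in U e -> mx_in U f -> mx_in U x -> mx_in U y ->
  e *m e = e -> f *m f = f -> e *m x = x -> x *m f = x -> f *m y = y -> y *m e = y ->
  mnorm (e - x *m y) <= 2^-1 -> mnorm (f - y *m x) <= 2^-1 ->
  exists z, [/\ mx_in U z, x *m z = e & z *m x = f].
Proof.
move=> Ue Uf Ux Uy ee ff ex xf fy ye h1 h2.
have [s [Us rs ls]] := neumann (mx_inB Ue (mx_inM Ux Uy)) h1.
have [s' [Us' rs' ls']] := neumann (mx_inB Uf (mx_inM Uy Ux)) h2.
have E1 : x *m y = e *m (1%:M - (e - x *m y)).
  by rewrite !mulmxBr mulmx1 ee mulmxA ex subKr.
have E2 : y *m x = (1%:M - (f - y *m x)) *m f.
  by rewrite !mulmxBl mul1mx ff -mulmxA xf subKr.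
have R1 : x *m (y *m s) = e by rewrite mulmxA E1 -mulmxA rs mulmx1.
have R2 : (s' *m y) *m x = f by rewrite -mulmxA E2 mulmxA ls' mul1mx.
exists (f *m (y *m s)); split; first exact: mx_inM Uf (mx_inM Uy Us).
  by rewrite mulmxA xf.
have -> : f *m (y *m s) = s' *m y by rewrite -R2 -mulmxA R1 -mulmxA ye.
exact: R2.
Qed.

End subring_matrices.
End matrix_norm.

(** One step of Newton's iteration a := 3 a^2 - 2 a^3 for the equation a^2 = a, written with
  the defect s = a - a^2 and u = 1 - 2 a, whose square is 1 - 4 s: the new defect is of
  second order in s. *)
Lemma newton_defect (B : pzRingType) (a s u : B) :
  s = a - a * a -> u = 1 - a *+ 2 ->
  (a - u * s) - (a - u * s) * (a - u * s) = (s * s) *+ 3 + (s * s * s) *+ 4 /\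
  1 - (a - u * s) *+ 2 = u + (u * s) *+ 2.
Proof.
move=> sE uE.
have as_ : a * s = s * a by rewrite sE mulrBl mulrBr mulrA.
have us : u * s = s * u by rewrite uE mulrBl mulrBr mul1r mulr1 mulrnAl mulrnAr as_.
have au : a * u = u * a by rewrite uE mulrBl mulrBr mul1r mulr1 mulrnAl mulrnAr.
have uu : u * u = 1 - s *+ 4.
  rewrite uE mulrBl mul1r mulrBr mulr1 mulrnAl mulrnAr -mulrnA sE mulrnBl !opprB.
  by rewrite -addrA; congr (_ + _); rewrite addrCA -opprD -mulrnDr.
set r := u * s.
have ar : a * r = r * a by rewrite /r -mulrA -as_ !mulrA au.
have ur : u * r = s - (s * s) *+ 4 by rewrite /r mulrA uu mulrBl mul1r mulrnAl.
have rr : r * r = s * s - (s * s * s) *+ 4.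
  by rewrite {1}/r us -mulrA ur mulrBr mulrnAr mulrA.
split; last by rewrite mulrnBl opprB addrA addrAC uE.
have -> : a - r - (a - r) * (a - r) = s - u * r - r * r.
  rewrite mulrBl !mulrBr ar sE uE mulrBl mul1r mulrnAl ar mulr2n.
  by rewrite !opprB [LHS](AC (2*(2*2)) ((1*6)*((3*5)*2)*4)).
rewrite ur rr opprB opprB addrA [s + _]addrC subrK.
by rewrite mulrSr addrAC addrK.
Qed.

Section lifting.
Context {R : realType} {A : pzRingType} {nu : A -> R}.
Context (nuP : complete_ring_norm nu).
Local Notation mnorm := (@mnorm R A nu _ _).

Lemma mnormMn m n (X : 'M_(m, n)) k : mnorm (X *+ k) <= mnorm X *+ k.
Proof.
elim: k => [|k IH]; first by rewrite !mulr0n (mnorm0 nuP).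
by rewrite !mulrS (le_trans (mnormD nuP _ _))// lerD2l.
Qed.

Lemma mx_inMn (U : set A) (UP : closed_subring nu U) m n (X : 'M_(m, n)) k :
  mx_in U X -> mx_in U (X *+ k).
Proof.
move=> UX; elim: k => [|k IH]; last by rewrite mulrS; exact: (mx_inD UP).
by rewrite mulr0n => i j; rewrite mxE; exact: (closed_subring0 UP).
Qed.

(** An almost idempotent matrix is close to an idempotent, the limit of Newton's iteration.
  The defects decrease at least geometrically and the norms of 1 - 2 u_k at most double, so
  the steps, which are their products, are summable. *)
Lemma idempotent_lift (U : set A) (UP : closed_subring nu U) n (a : 'M_n) :
  mx_in U a -> mnorm (a - a *m a) <= 16^-1 ->
  exists f, [/\ mx_in U f, f *m f = f &
    mnorm (f - a) <= 8 * mnorm (1%:M - a *+ 2) * mnorm (a - a *m a)].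
Proof.
move=> Ua sg.
pose S (b : 'M[A]_n) := b - b *m b; pose V (b : 'M[A]_n) := 1%:M - b *+ 2.
pose u := fix u k : 'M[A]_n := if k is k'.+1 then u k' - V (u k') *m S (u k') else a.
have Uu k : mx_in U (u k).
  elim: k => [|k IH] //=; apply: (mx_inB UP) => //; apply: (mx_inM UP).
    by apply: (mx_inB UP); [exact: (mx_in1 UP)|exact: (mx_inMn UP)].
  by apply: (mx_inB UP) => //; exact: (mx_inM UP).
pose sg0 := mnorm (S a); pose W := mnorm (V a).
have sg00 : 0 <= sg0 by exact: mnorm_ge0.
have W0 : 0 <= W by exact: mnorm_ge0.
have step k : S (u k.+1) = (S (u k) *m S (u k)) *+ 3 + (S (u k) *m S (u k) *m S (u k)) *+ 4
    /\ V (u k.+1) = V (u k) + (V (u k) *m S (u k)) *+ 2.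
  exact: (@newton_defect 'M[A]_n (u k) (S (u k)) (V (u k)) erefl erefl).
have Sk k : mnorm (S (u k)) <= sg0 / 2 ^+ k.
  elim: k => [|k IH]; first by rewrite expr0 divr1.
  have [-> _] := step k.
  set x := mnorm (S (u k)) in IH.
  have x0 : 0 <= x by exact: mnorm_ge0.
  have x1 : x <= 16^-1.
    apply: le_trans IH (le_trans _ sg); rewrite ler_pdivrMr ?exprn_gt0//.
    by rewrite ler_peMr// exprn_ege1// ler1n.
  rewrite (le_trans (mnormD nuP _ _))//.
  apply: (@le_trans _ _ ((x * x) *+ 3 + (x * x * x) *+ 4)).
    rewrite lerD// (le_trans (mnormMn _ _))// lerMn2r//= ?(mnormM nuP)//.
    rewrite (le_trans (mnormM nuP _ _))// ler_wpM2r ?(mnormM nuP)//.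
  apply: (@le_trans _ _ (x / 2)).
    rewrite -mulr_natr -(mulr_natr (x * x * x)); nra.
  by rewrite exprS invfM [2^-1 * _]mulrC mulrA ler_wpM2r ?invr_ge0.
have Vk k : mnorm (V (u k)) <= W * (2 - 2^-1 ^+ k).
  elim: k => [|k IH]; first by rewrite expr0 mulr2n addrK mulr1.
  have [_ ->] := step k.
  rewrite (le_trans (mnormD nuP _ _))//.
  set v := mnorm (V (u k)) in IH *.
  have v0 : 0 <= v by exact: mnorm_ge0.
  apply: (@le_trans _ _ (v + 2 * (v * (sg0 * 2^-1 ^+ k)))).
    rewrite lerD2l (le_trans (mnormMn _ _))// -[leLHS]mulr_natl ler_wpM2l//.
    by rewrite (le_trans (mnormM nuP _ _))// ler_wpM2l// exprVn.
  rewrite exprS; set q := 2^-1 ^+ k in IH *.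
  have q0 : 0 <= q by rewrite exprn_ge0 ?invr_ge0.
  have q1 : q <= 1 by rewrite exprn_ile1 ?invr_ge0// invf_le1// ler1n.
  have sg1 : sg0 <= 16^-1 by [].
  have vW : v <= 2 * W by apply: le_trans IH _; nra.
  have h1 : v * sg0 <= 2 * W * 16^-1 by apply: ler_pM.
  have h2 : v * sg0 * q <= 2 * W * 16^-1 * q by apply: ler_wpM2r.
  nra.
have du k : mnorm (u k.+1 - u k) <= 2 * W * sg0 / 2 ^+ k.
  rewrite /= addrAC subrr add0r (le_trans (mnormN nuP _))//.
  rewrite (le_trans (mnormM nuP _ _))// -mulrA ler_pM ?mnorm_ge0//.
  rewrite (le_trans (Vk k))// mulrC ler_wpM2r// gerBl exprn_ge0 ?invr_ge0//.
have [f [c [Uf fP]]] := mnorm_limit nuP UP Uu du.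
exists f; split=> //; last first.
  have tot k : mnorm (u k - a) <= 2 * (2 * W * sg0) * (1 - 2^-1 ^+ k).
    elim: k => [|k IH]; first by rewrite /= subrr (mnorm0 nuP) expr0 subrr mulr0.
    rewrite -[u k.+1](subrK (u k)) -addrA (le_trans (mnormD nuP _ _))//.
    move: (du k) IH; rewrite -exprVn exprS; set q := _ ^+ k; lra.
  rewrite -subr_le0; apply: (@geometric_le0 _ _ c) => k.
  rewrite lerBlDr -[f](subrK (u k)) -addrA (le_trans (mnormD nuP _ _))//.
  rewrite lerD// (le_trans (tot k))//.
  rewrite -/(S a) -/(V a) -/W -/sg0.
  have q0 : 0 <= 2^-1 ^+ k :> R by rewrite exprn_ge0 ?invr_ge0.
  have Wsg : 0 <= W * sg0 by exact: mulr_ge0.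
  move: q0; set q := 2^-1 ^+ k; nra.
have c0 : 0 <= c by have := le_trans (mnorm_ge0 nuP _) (fP 0%N); rewrite expr0 divr1.
apply/eqP; rewrite -subr_eq0; apply/eqP/(mnorm_eq0 nuP).
apply: (@geometric_le0 _ _ (sg0 + c * (1 + 2 * mnorm f + c))) => k.
have -> : f *m f - f = (f - u k) *m u k + f *m (f - u k) - (f - u k) - S (u k).
  rewrite mulmxBl mulmxBr /S !opprB [RHS](AC (2*2*2*2) ((3*6)*(1*4)*(7*2)*(5*8))).
  by rewrite /= !subrr !addr0.
have d0 := mnorm_ge0 nuP (f - u k).
have fk := fP k.
have uf : mnorm (u k) <= mnorm f + c.
  rewrite -[u k](subKr f) (le_trans (mnormB nuP _ _))// lerD2l.
  by apply: le_trans fk _; rewrite ler_pdivrMr ?exprn_gt0// ler_peMr// exprn_ege1// ler1n.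
apply: le_trans (mnormB nuP _ _) _; rewrite addrC mulrDl lerD// -mulrA.
apply: (@le_trans _ _ (mnorm (f - u k) * (1 + 2 * mnorm f + c))).
  rewrite (le_trans (mnormB nuP _ _))//.
  have h1 : mnorm ((f - u k) *m u k) <= mnorm (f - u k) * (mnorm f + c).
    by rewrite (le_trans (mnormM nuP _ _))// ler_wpM2l.
  have h2 : mnorm (f *m (f - u k)) <= mnorm f * mnorm (f - u k) by exact: mnormM.
  have h3 := mnormD nuP ((f - u k) *m u k) (f *m (f - u k)).
  lra.
rewrite [leRHS]mulrCA [leLHS]mulrC ler_wpM2l//.
by rewrite !addr_ge0// ?mulr_ge0// mnorm_ge0.
Qed.

Lemma closed_subringT : closed_subring nu setT.
Proof. by []. Qed.

Definition mvn_in (U : set A) m n (e : 'M[A]_m) (f : 'M[A]_n) :=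
  exists x y, [/\ mx_in U x, mx_in U y, x *m y = e & y *m x = f].

(** The equivalence is x = e f with y = f e, corrected by [approx_mvn]. *)
Lemma near_idempotents_mvn (U : set A) (UP : closed_subring nu U) n (e f : 'M_n) :
  mx_in U e -> mx_in U f -> e *m e = e -> f *m f = f ->
  mnorm e * mnorm (e - f) * mnorm e <= 2^-1 ->
  mnorm f * mnorm (e - f) * mnorm f <= 2^-1 -> mvn_in U e f.
Proof.
move=> Ue Uf ee ff h1 h2.
have [||||||z [Uz xz zx]] := approx_mvn nuP UP (x := e *m f) (y := f *m e) Ue Uf
    (mx_inM UP Ue Uf) (mx_inM UP Uf Ue) ee ff.
- by rewrite mulmxA ee.
- by rewrite -mulmxA ff.
- by rewrite mulmxA ff.
- by rewrite -mulmxA ee.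
- apply: le_trans h1.
  have -> : e - e *m f *m (f *m e) = e *m (e - f) *m e.
    by rewrite mulmxBr mulmxBl ee ee !mulmxA -[e *m f *m f]mulmxA ff.
  rewrite (le_trans (mnormM nuP _ _))// ler_wpM2r ?(mnorm_ge0 nuP)//; exact: mnormM.
- apply: le_trans h2.
  have -> : f - f *m e *m (e *m f) = f *m (f - e) *m f.
    by rewrite mulmxBr mulmxBl ff ff !mulmxA -[f *m e *m e]mulmxA ee.
  rewrite (mnorm_distC nuP e f).
  rewrite (le_trans (mnormM nuP _ _))// ler_wpM2r ?(mnorm_ge0 nuP)//; exact: mnormM.
by exists (e *m f), z; split=> //; exact: (mx_inM UP).
Qed.

Section dense_union.
Context (U : nat -> set A) (UP : forall n, closed_subring nu (U n)).
Context (Uincr : forall n, U n `<=` U n.+1).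
Context (Udense : forall x e, 0 < e -> exists n y, U n y /\ nu (x - y) < e).

Lemma filtration_le m n : (m <= n)%N -> U m `<=` U n.
Proof.
move=> /subnK <-; elim: (n - m)%N => [|k IH]; first by rewrite add0n.
by rewrite addSn; apply: subset_trans IH _; exact: Uincr.
Qed.

Lemma mx_in_le k l m n (X : 'M_(m, n)) :
  (k <= l)%N -> mx_in (U k) X -> mx_in (U l) X.
Proof. by move=> kl h i j; exact: filtration_le (h i j). Qed.

Lemma mx_dense n0 m n (X : 'M_(m, n)) e : 0 < e ->
  exists k Y, [/\ (n0 <= k)%N, mx_in (U k) Y & mnorm (X - Y) <= e].
Proof.
move=> e0; pose e1 := e / (m * n).+1%:R.
have e10 : 0 < e1 by rewrite divr_gt0.
have /fin_all_exists[k /fin_all_exists[Y hY]] : forall ij : 'I_m * 'I_n, exists k y,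
    U k y /\ nu (X ij.1 ij.2 - y) < e1 by move=> ij; exact: Udense.
pose K := maxn n0 (\max_ij k ij).
exists K, (\matrix_(i, j) Y (i, j)); split; first exact: leq_maxl.
  move=> i j; rewrite mxE; apply: filtration_le (proj1 (hY (i, j))).
  by rewrite (leq_trans _ (leq_maxr _ _))// (leq_bigmax (i, j)).
apply: (@le_trans _ _ (\sum_(i < m) \sum_(j < n) e1)).
  by apply: ler_sum => i _; apply: ler_sum => j _; rewrite !mxE ltW//; case: (hY (i, j)).
rewrite !sumr_const !card_ord -mulrnA -[leLHS]mulr_natl mulnC /e1 mulrCA.
by rewrite ler_piMr ?(ltW e0)// ler_pdivrMr// mul1r ler_nat.
Qed.

(** An approximation of e by a matrix a over some U k is almost idempotent; the idempotent
  that it lifts to is close to a, hence to e, hence equivalent to e. *)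
Lemma idempotent_mvn_filtration n (e : 'M_n) : e *m e = e ->
  exists k (f : 'M_n), [/\ mx_in (U k) f, f *m f = f & mvn_in setT e f].
Proof.
move=> ee; set M := mnorm e; have M0 : 0 <= M by exact: mnorm_ge0.
pose W := mnorm (1%:M : 'M_n) + 2 * (M + 1).
have W0 : 0 <= W by rewrite addr_ge0 ?(mnorm_ge0 nuP)// mulr_ge0// addr_ge0.
pose K := 1 + 8 * W * (2 + 2 * M).
have K1 : 1 <= K by rewrite lerDl !mulr_ge0// addr_ge0// mulr_ge0.
have M1 : 1 <= M + 1 by rewrite lerDr.
have d0 : 0 < (32 * ((M + 1) * (M + 1) * K))^-1.
  by rewrite invr_gt0 !mulr_gt0//; lra.
(* For a matrix a at distance at most d from e, the defect of a is at most d (2 + 2 M), and the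
   idempotent that a lifts to is at distance at most d K from e. *)
move: d0; set d := (_ : R)^-1 => d0.
have dK : d * K * ((M + 1) * (M + 1)) = 32^-1.
  rewrite -mulrA [K * _]mulrC /d invfM -[LHS]mulrA mulVf ?mulr1//.
  by rewrite gt_eqF// !mulr_gt0//; lra.
have dM : d * (2 + 2 * M) <= 16^-1.
  have : d * (M + 1) * (M + 1) <= 32^-1.
    by rewrite -dK -[leLHS]mulrA ler_wpM2r ?ler_peMr ?(ltW d0)// mulr_ge0//; lra.
  have : d * (M + 1) <= d * (M + 1) * (M + 1) by rewrite ler_peMr// mulr_ge0 ?(ltW d0)//; lra.
  lra.
have dK1 : d * K <= 32^-1.
  by rewrite -dK ler_peMr ?mulr_ege1// mulr_ge0 ?(ltW d0)//; lra.
have [k [a [_ Ua ea]]] := mx_dense 0 e d0.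
have d1 : d <= 1 by apply: le_trans (_ : d * K <= 1); [rewrite ler_peMr// ltW|lra].
have aM : mnorm a <= M + 1.
  rewrite -[a](subKr e) (le_trans (mnormB nuP _ _))// lerD2l; exact: le_trans ea d1.
have sa : mnorm (a - a *m a) <= d * (2 + 2 * M).
  have -> : a - a *m a = (a - e) - ((a - e) *m a + e *m (a - e)).
    by rewrite mulmxBl mulmxBr ee addrA subrK opprB addrA subrK.
  rewrite (mnorm_distC nuP) in ea.
  have h1 : mnorm ((a - e) *m a) <= d * (M + 1).
    by rewrite (le_trans (mnormM nuP _ _))// ler_pM ?(mnorm_ge0 nuP).
  have h2 : mnorm (e *m (a - e)) <= M * d.
    by rewrite (le_trans (mnormM nuP _ _))// ler_wpM2l.
  have h3 := mnormB nuP (a - e) ((a - e) *m a + e *m (a - e)).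
  have h4 := mnormD nuP ((a - e) *m a) (e *m (a - e)).
  lra.
have [f [Uf ff fa]] := idempotent_lift (UP k) Ua (le_trans sa dM).
have Va : mnorm (1%:M - a *+ 2) <= W.
  rewrite (le_trans (mnormB nuP _ _))// lerD2l (le_trans (mnormMn _ _))//.
  by rewrite -[leLHS]mulr_natl ler_wpM2l.
have ef : mnorm (e - f) <= d * K.
  rewrite -[e](subrK a) -addrA (le_trans (mnormD nuP _ _))//.
  rewrite /K mulrDr mulr1 lerD//.
  rewrite (mnorm_distC nuP) (le_trans fa)// mulrCA -mulrA.
  rewrite -!mulrA ler_wpM2l// ler_pM ?(mnorm_ge0 nuP)//.
have fM : mnorm f <= M + 1.
  rewrite -[f](subKr e) (le_trans (mnormB nuP _ _))// lerD2l; lra.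
exists k, f; split=> //.
have b x : 0 <= x -> x <= M + 1 -> x * mnorm (e - f) * x <= 2^-1.
  move=> x0 xM; apply: (@le_trans _ _ 32^-1); last by lra.
  by rewrite -dK mulrC mulrA mulrC ler_pM ?(mnorm_ge0 nuP) ?mulr_ge0// ler_pM.
apply: (near_idempotents_mvn closed_subringT) => //; apply: b; rewrite ?(mnorm_ge0 nuP)//.
by rewrite lerDl.
Qed.

(** An equivalence (x, y) over the closure, cut down to the corners of p and q, is
  approximated over some U l; the approximation is an equivalence up to the correction
  of [approx_mvn]. *)
Lemma mvn_filtration n0 m n (p : 'M_m) (q : 'M_n) :
  mx_in (U n0) p -> mx_in (U n0) q -> p *m p = p -> q *m q = q ->
  mvn_in setT p q -> exists2 k, (n0 <= k)%N & mvn_in (U k) p q.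
Proof.
move=> Up Uq pp qq [x [y [_ _ xyp yxq]]].
wlog [px xq qy yp] : x y xyp yxq / [/\ p *m x = x, x *m q = x, q *m y = y & y *m p = y].
  move=> wl; apply: (wl (p *m x *m q) (q *m y *m p)).
  - rewrite !mulmxA -[_ *m q *m q]mulmxA qq -yxq !mulmxA -[_ *m x *m y]mulmxA xyp.
    by rewrite -[_ *m x *m y]mulmxA xyp !pp.
  - rewrite !mulmxA -[_ *m p *m p]mulmxA pp -xyp !mulmxA -[_ *m y *m x]mulmxA yxq.
    by rewrite -[_ *m y *m x]mulmxA yxq !qq.
  - by rewrite !mulmxA pp qq -!mulmxA pp qq.
pose c := mnorm p * mnorm q.
have c0 : 0 <= c by rewrite mulr_ge0 ?(mnorm_ge0 nuP).
pose b := mnorm x + mnorm y + 1.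
have b0 : 0 < b by rewrite ltr_wpDl// addr_ge0 ?(mnorm_ge0 nuP).
pose d := (2 * b)^-1.
have d0 : 0 < d by rewrite invr_gt0 mulr_gt0.
have d1 : d <= 1.
  by rewrite invf_le1 ?mulr_gt0//; have := mnorm_ge0 nuP x; have := mnorm_ge0 nuP y; rewrite /b; lra.
pose dd := d / (c + 1).
have dc0 : 0 < dd by rewrite divr_gt0// ltr_wpDl.
have [k [x0 [nk Ux xx0]]] := mx_dense n0 x dc0.
have [l [y0 [kl Uy yy0]]] := mx_dense k y dc0.
(* The tolerance d keeps both errors, at most d b, below one half; dd makes up for the norms
   of p and q. *)
have dc : c * dd <= d.
  by rewrite /dd mulrCA ler_piMr ?(ltW d0)// ler_pdivrMr ?ltr_wpDl// mul1r lerDl.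
have nl := leq_trans nk kl.
have {}Up := mx_in_le nl Up; have {}Uq := mx_in_le nl Uq; have {}Ux := mx_in_le kl Ux.
pose x1 := p *m x0 *m q; pose y1 := q *m y0 *m p.
have Ux1 : mx_in (U l) x1 by apply: (mx_inM (UP l)) => //; exact: (mx_inM (UP l)).
have Uy1 : mx_in (U l) y1 by apply: (mx_inM (UP l)) => //; exact: (mx_inM (UP l)).
have xx1 : mnorm (x - x1) <= d.
  have -> : x - x1 = p *m (x - x0) *m q by rewrite mulmxBr mulmxBl px xq.
  apply: le_trans dc; rewrite (le_trans (mnormM nuP _ _))// /c [leRHS]mulrAC.
  by rewrite ler_wpM2r ?(mnorm_ge0 nuP)// (le_trans (mnormM nuP _ _))// ler_wpM2l ?(mnorm_ge0 nuP).
have yy1 : mnorm (y - y1) <= d.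
  have -> : y - y1 = q *m (y - y0) *m p by rewrite mulmxBr mulmxBl qy yp.
  apply: le_trans dc; rewrite (le_trans (mnormM nuP _ _))// /c (mulrC (mnorm p) (mnorm q)) [leRHS]mulrAC.
  by rewrite ler_wpM2r ?(mnorm_ge0 nuP)// (le_trans (mnormM nuP _ _))// ler_wpM2l ?(mnorm_ge0 nuP).
have xn := mnorm_ge0 nuP x; have yn := mnorm_ge0 nuP y.
have x1n : mnorm x1 <= mnorm x + 1.
  rewrite -[x1](subKr x) (le_trans (mnormB nuP _ _))// lerD2l; exact: le_trans xx1 d1.
have y1n : mnorm y1 <= mnorm y + 1.
  rewrite -[y1](subKr y) (le_trans (mnormB nuP _ _))// lerD2l; exact: le_trans yy1 d1.
have db : d * b = 2^-1 by rewrite /d invfM -mulrA mulVf ?mulr1// gt_eqF.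
have [||||||z [Uz xz zx]] := approx_mvn nuP (UP l) (x := x1) (y := y1) Up Uq Ux1 Uy1 pp qq.
- by rewrite /x1 !mulmxA pp.
- by rewrite /x1 -!mulmxA qq.
- by rewrite /y1 !mulmxA qq.
- by rewrite /y1 -!mulmxA pp.
- have -> : p - x1 *m y1 = (x - x1) *m y + x1 *m (y - y1).
    by rewrite mulmxBl mulmxBr xyp addrA subrK.
  rewrite -db (le_trans (mnormD nuP _ _))//.
  have h1 : mnorm ((x - x1) *m y) <= d * mnorm y.
    by rewrite (le_trans (mnormM nuP _ _))// ler_wpM2r.
  have h2 : mnorm (x1 *m (y - y1)) <= (mnorm x + 1) * d.
    by rewrite (le_trans (mnormM nuP _ _))// ler_pM ?(mnorm_ge0 nuP).
  rewrite /b; lra.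
- have -> : q - y1 *m x1 = (y - y1) *m x + y1 *m (x - x1).
    by rewrite mulmxBl mulmxBr yxq addrA subrK.
  rewrite -db (le_trans (mnormD nuP _ _))//.
  have h1 : mnorm ((y - y1) *m x) <= d * mnorm x.
    by rewrite (le_trans (mnormM nuP _ _))// ler_wpM2r.
  have h2 : mnorm (y1 *m (x - x1)) <= (mnorm y + 1) * d.
    by rewrite (le_trans (mnormM nuP _ _))// ler_pM ?(mnorm_ge0 nuP).
  rewrite /b; lra.
by exists l => //; exists x1, z.
Qed.

End dense_union.
End lifting.

(** * Completeness of the operators on ell^p *)

Section ell_p_norm.
Context {R : realType} {T : choiceType} {p : R} {p1 : 1 <= p}.
Local Notation C := (R[i]^o).
Local Notation L := (ell T p1).

Let p0 : 0 < p. Proof. exact: lt_le_trans ltr01 p1. Qed.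

Lemma ell_norm_powR (f : L) : (ell_norm f `^ p)%:E = psum p f.
Proof.
rewrite /ell_norm -powRrM mulVf ?gt_eqF// powRr1 ?fine_ge0 ?psum_ge0//.
by rewrite fineK ?psum_fin.
Qed.

Lemma ell_norm_le (f : L) M : 0 <= M ->
  (psum p f <= (M `^ p)%:E)%E -> ell_norm f <= M.
Proof.
move=> M0; rewrite -ell_norm_powR lee_fin => h; rewrite leNgt; apply/negP => Mf.
by move: h; rewrite leNgt gt0_ltr_powR// ?nnegrE// ell_norm_ge0.
Qed.

Lemma normc_le_ell_norm (f : L) x : normc (f x) <= ell_norm f.
Proof.
have : ((normc (f x) `^ p)%:E <= psum p f)%E.
  apply: esum_ge; exists [set x]; first by split.
  by rewrite fsbig_set1.
rewrite -ell_norm_powR lee_fin => h; rewrite leNgt; apply/negP => Mf.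
by move: h; rewrite leNgt gt0_ltr_powR// ?nnegrE ?normc_ge0 ?ell_norm_ge0.
Qed.

(* Keeps unification from unfolding the norm. *)
#[local] Opaque ell_norm.

Lemma ell_norm_eq0 (f : L) : ell_norm f = 0 -> f = 0.
Proof.
move=> f0; apply: val_inj; apply/funext => x; apply: ComplexField.Normc.eq0_normc.
by apply/eqP; rewrite eq_le normc_ge0 andbT -f0 normc_le_ell_norm.
Qed.

Lemma powR_convex (t u v : R) : 0 <= t <= 1 -> 0 <= u -> 0 <= v ->
  (t * u + (1 - t) * v) `^ p <= t * u `^ p + (1 - t) * v `^ p.
Proof.
move=> /andP[t0 t1] u0 v0.
by apply: (convex_powR p1 (Itv01 t0 t1)); rewrite inE /= in_itv /= andbT.
Qed.

(** Convexity of the p-th power, with weights a / (a + b) and b / (a + b), at u / a and v / b. *)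
Lemma powR_weighted (a b u v : R) : 0 < a -> 0 < b -> 0 <= u -> 0 <= v ->
  (u + v) `^ p <= (a + b) `^ p * (a / (a + b) / a `^ p) * u `^ p
    + (a + b) `^ p * (b / (a + b) / b `^ p) * v `^ p.
Proof.
move=> a0 b0 u0 v0.
have ab0 : 0 < a + b := addr_gt0 a0 b0.
have t01 : 0 <= a / (a + b) <= 1.
  by rewrite divr_ge0 ?(ltW a0) ?(ltW ab0)//= ler_pdivrMr// mul1r lerDl (ltW b0).
have t1E : 1 - a / (a + b) = b / (a + b).
  by rewrite -{1}(@divff _ (a + b)) ?gt_eqF// -mulrBl addrC addKr.
have ua : 0 <= u / a by rewrite divr_ge0// ltW.
have vb : 0 <= v / b by rewrite divr_ge0// ltW.
have := powR_convex t01 ua vb; rewrite t1E => h.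
have uvE : u + v = (a + b) * (a / (a + b) * (u / a) + b / (a + b) * (v / b)).
  by field; rewrite !gt_eqF.
rewrite {1}uvE powRM ?(ltW ab0)//; last first.
  by rewrite addr_ge0// mulr_ge0// divr_ge0 ?(ltW a0) ?(ltW b0) ?(ltW ab0).
apply: le_trans (ler_wpM2l (powR_ge0 _ _) h) _.
rewrite !powRM ?invr_ge0 ?(ltW a0) ?(ltW b0)// -(powR_inv1 (ltW a0)) -(powR_inv1 (ltW b0)).
rewrite -!powRrM !mulN1r !powRN.
by rewrite le_eqVlt; apply/orP; left; apply/eqP; ring.
Qed.

(** Minkowski's inequality is the sum over x of [powR_weighted] at |f x| and |g x|, for a and
  b the two norms: the coefficients are such that both sums contribute a multiple of
  (a + b)^p, the multiples being the weights. *)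
Lemma ler_ell_normD (f g : L) : ell_norm (f + g) <= ell_norm f + ell_norm g.
Proof.
have [f0|fn0] := eqVneq (ell_norm f) 0; first by rewrite (ell_norm_eq0 f0) ell_norm0 !add0r.
have [g0|gn0] := eqVneq (ell_norm g) 0; first by rewrite (ell_norm_eq0 g0) ell_norm0 !addr0.
have : 0 < ell_norm f by rewrite lt_neqAle eq_sym fn0 ell_norm_ge0.
have : 0 < ell_norm g by rewrite lt_neqAle eq_sym gn0 ell_norm_ge0.
move: (ell_norm_powR f) (ell_norm_powR g) => {fn0 gn0}.
move: (ell_norm f) (ell_norm g) => a b fE gE b0 a0.
have ab0 : 0 < a + b := addr_gt0 a0 b0.
apply: ell_norm_le; first exact: ltW.
pose cf := (a + b) `^ p * (a / (a + b) / a `^ p).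
pose cg := (a + b) `^ p * (b / (a + b) / b `^ p).
have c0 (c : R) : 0 < c -> 0 <= (a + b) `^ p * (c / (a + b) / c `^ p).
  by move=> c0; rewrite mulr_ge0 ?powR_ge0// divr_ge0 ?powR_ge0// divr_ge0// ltW.
have cf0 : 0 <= cf := c0 _ a0.
have cg0 : 0 <= cg := c0 _ b0.
have le_sum : (psum p (f + g)%R <= cf%:E * psum p f + cg%:E * psum p g)%E.
  apply: (@le_trans _ _ (\esum_(x in [set: T])
      ((cf * normc (f x) `^ p)%:E + (cg * normc (g x) `^ p)%:E))%E).
    apply: le_esum => x _; rewrite -EFinD lee_fin.
    apply: le_trans (powR_weighted a0 b0 (normc_ge0 _) (normc_ge0 _)).
    apply: ge0_ler_powR; rewrite ?nnegrE ?normc_ge0 ?addr_ge0 ?normc_ge0 ?(ltW p0)//.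
    exact: le_normcD.
  rewrite esumD; try by move=> x _; rewrite lee_fin mulr_ge0 ?powR_ge0.
  by apply: leeD; apply: esumZ => // x; exact: powR_ge0.
apply: (le_trans le_sum); rewrite -fE -gE -!EFinM -EFinD lee_fin.
rewrite /cf /cg -!mulrA !mulVf ?gt_eqF ?powR_gt0// !mulr1 -mulrDr -mulrDl.
by rewrite mulfV ?mulr1// gt_eqF.
Qed.

End ell_p_norm.

Section geometric_limits.
Context {R : realType}.

(** The intervals of center r k and radius 2 c / 2^k are nested. *)
Lemma real_geometric_limit (r : nat -> R) (c : R) :
  (forall k, `|r k.+1 - r k| <= c / 2 ^+ k) ->
  exists l, forall k, `|l - r k| <= 2 * c / 2 ^+ k.
Proof.
move=> hr; pose e k := 2 * c / 2 ^+ k.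
have eS k : e k = e k.+1 + c / 2 ^+ k.
  by rewrite /e exprS invfM; set q := _^-1; lra.
have c0 : 0 <= c by have := le_trans (normr_ge0 _) (hr 0%N); rewrite expr0 divr1.
have e0 k : 0 <= e k by rewrite divr_ge0 ?mulr_ge0 ?exprn_ge0.
have lo j k : r j - e j <= r (j + k)%N - e (j + k)%N.
  elim: k => [|k IH]; first by rewrite addn0.
  apply: le_trans IH _; rewrite addnS; have := hr (j + k)%N; rewrite ler_norml => /andP[h _].
  by rewrite (eS (j + k)%N); lra.
have hi j k : r (j + k)%N + e (j + k)%N <= r j + e j.
  elim: k => [|k IH]; first by rewrite addn0.
  apply: le_trans _ IH; rewrite addnS; have := hr (j + k)%N; rewrite ler_norml => /andP[_ h].
  by rewrite (eS (j + k)%N); lra.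
have lohi j k : r j - e j <= r k + e k.
  have := lo j k; have := hi k j; have := e0 (j + k)%N; rewrite [(k + j)%N]addnC; lra.
exists (sup (range (fun k => r k - e k))) => k; rewrite ler_distl; apply/andP; split.
  apply: ub_le_sup; last by exists k.
  by exists (r 0%N + e 0%N) => _ [j _ <-].
by apply: ge_sup => [|_ [j _ <-]//]; exists (r 0%N - e 0%N), 0%N.
Qed.

Lemma complex_geometric_limit (z : nat -> R[i]) (c : R) :
  (forall k, normc (z k.+1 - z k) <= c / 2 ^+ k) ->
  exists l, forall k, normc (l - z k) <= 4 * c / 2 ^+ k.
Proof.
move=> hz.
have ReIm (w : R[i]) : `|complex.Re w| <= normc w /\ `|complex.Im w| <= normc w.
  by case: w => a b /=; split; rewrite -sqrtr_sqr ler_wsqrtr// ?lerDl ?lerDr sqr_ge0.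
have [|a ha] := @real_geometric_limit (fun k => complex.Re (z k)) c.
  move=> k; apply: le_trans (hz k); have [h1 h2] := ReIm (z k.+1 - z k).
  by move: h1 h2; case: (z k.+1) (z k) => [? ?] [? ?].
have [|b hb] := @real_geometric_limit (fun k => complex.Im (z k)) c.
  move=> k; apply: le_trans (hz k); have [h1 h2] := ReIm (z k.+1 - z k).
  by move: h1 h2; case: (z k.+1) (z k) => [? ?] [? ?].
exists (a +i* b)%C => k.
have -> : (a +i* b)%C - z k = ((a - complex.Re (z k))%:C + 'i * (b - complex.Im (z k))%:C)%C.
  by case: (z k) => x y; apply/eqP; rewrite eq_complex /=; apply/andP; split; apply/eqP; ring.
apply: le_trans (le_normcD _ _) _.
rewrite ComplexField.Normc.normcM !normc_real [X in X * _](_ : _ = 1); last first.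
  by rewrite /= expr0n expr1n add0r sqrtr1.
rewrite mul1r; have := ha k; have := hb k; lra.
Qed.

End geometric_limits.

Section ell_p_complete.
Context {R : realType} {T : choiceType} {p : R} (p1 : 1 <= p).
Local Notation C := (R[i]^o).
Local Notation L := (ell T p1).
Implicit Types (X : {fset T}) (h : T -> C).

Let p0 : 0 < p. Proof. exact: lt_le_trans ltr01 p1. Qed.

Lemma ell_valE (f g : L) : (forall x, f x = g x) -> f = g.
Proof. by move=> fg; apply: val_inj; apply/funext. Qed.

Lemma ell_sum_val (I : Type) (r : seq I) (f : I -> L) x :
  (\sum_(i <- r) f i) x = \sum_(i <- r) f i x.
Proof. by elim/big_ind2 : _ => // f1 a1 f2 a2 <- <-. Qed.

Lemma ler_ell_normB (f g : L) : ell_norm (f - g) <= ell_norm f + ell_norm g.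
Proof. by apply: le_trans (ler_ell_normD f (- g)) _; rewrite lerD2l ell_normN. Qed.

Lemma ler_ell_norm_sum (I : Type) (r : seq I) (f : I -> L) :
  ell_norm (\sum_(i <- r) f i) <= \sum_(i <- r) ell_norm (f i).
Proof.
elim/big_rec2 : _ => [|i y x _ xy]; first by rewrite ell_norm0.
by apply: le_trans (ler_ell_normD _ _) _; rewrite lerD2l.
Qed.

Lemma ell_norm_delta (y : T) : ell_norm (ell_delta p1 y) <= 1.
Proof.
apply: ell_norm_le => //; rewrite powR1 /psum (esumID [set y]); last first.
  by move=> x _; rewrite lee_fin powR_ge0.
rewrite setTI esum_set1 ?lee_fin ?powR_ge0//= eqxx ComplexField.Normc.normc1 powR1.
rewrite esum1 ?adde0// => x [_ /= /eqP/negPf ->].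
by rewrite ComplexField.Normc.normc0 powR0// gt_eqF.
Qed.

(** The function h is arbitrary because limits are restricted before they are known to be in
  ell^p. *)
Definition restriction X h : L := \sum_(y <- X) (h y : R[i]) *: ell_delta p1 y.

Lemma restrictionE X h x : restriction X h x = if x \in X then h x else 0.
Proof.
rewrite /restriction ell_sum_val.
rewrite (eq_bigr (fun y => (h y : R[i]) * (x == y)%:R)); last by [].
case: ifPn => xX; last first.
  rewrite big_seq big1// => y yX.
  by have [xy|] := eqVneq x y; [rewrite xy yX in xX|rewrite mulr0].
rewrite (big_fsetD1 x) //= eqxx mulr1 big1_fset ?addr0// => y.
by rewrite !inE => /andP[yx _] _; rewrite eq_sym (negPf yx) mulr0.
Qed.

Lemma restriction_norm_sum X h : ell_norm (restriction X h) <= \sum_(y <- X) normc (h y).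
Proof.
apply: le_trans (ler_ell_norm_sum _ _) _; apply: ler_sum => y _.
apply: le_trans (ell_normZ _ _) _.
by rewrite -[leRHS]mulr1 ler_wpM2l ?normc_ge0 ?ell_norm_delta.
Qed.

Lemma restriction_norm_le X (f : L) : ell_norm (restriction X f) <= ell_norm f.
Proof.
apply: ell_norm_le; first exact: ell_norm_ge0.
rewrite ell_norm_powR; apply: le_esum => x _; rewrite restrictionE lee_fin.
case: ifP => // _; rewrite ComplexField.Normc.normc0 powR0 ?gt_eqF//.
exact: powR_ge0.
Qed.

(** The p-norm is the supremum of the p-norms of the finite restrictions; so a function whose
  finite restrictions are uniformly bounded is in ell^p. *)
Lemma restriction_normP h M : 0 <= M -> (forall X, ell_norm (restriction X h) <= M) ->
  exists2 f : L, (forall x, f x = h x) & ell_norm f <= M.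
Proof.
move=> M0 hM; have hs : (psum p h <= (M `^ p)%:E)%E.
  apply: ge_ereal_sup => _ [A [finA _] <-].
  apply: (@le_trans _ _ (psum p (restriction (fset_set A) h))).
    apply: esum_ge; exists A; first by split.
    apply: lee_fsum => // x Ax; rewrite restrictionE in_fset_set//.
    by rewrite mem_set.
  rewrite -ell_norm_powR lee_fin ge0_ler_powR ?nnegrE ?ell_norm_ge0// ltW//.
have hL : h \in ell_pred T p1 by apply/asboolP; apply: le_lt_trans hs _; exact: ltry.
by exists (Ell hL) => //; exact: ell_norm_le.
Qed.

(** The limit is taken pointwise. On a finite set X pointwise convergence is convergence in
  norm, so the bound on u (k + j) - u k passes to the limit in j on each X. *)
Lemma ell_geometric_limit (u : nat -> L) c :
  (forall k, ell_norm (u k.+1 - u k) <= c / 2 ^+ k) ->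
  exists l : L, forall k, ell_norm (l - u k) <= 2 * c / 2 ^+ k.
Proof.
move=> hu.
have c0 : 0 <= c by have := le_trans (ell_norm_ge0 _) (hu 0%N); rewrite expr0 divr1.
have /choice[h hP] : forall x, exists z : R[i], forall k, normc (z - u k x) <= 4 * c / 2 ^+ k.
  move=> x; apply: complex_geometric_limit => k.
  by apply: le_trans (hu k); exact: (normc_le_ell_norm (u k.+1 - u k) x).
have tail k j : ell_norm (u (k + j)%N - u k) <= 2 * c / 2 ^+ k * (1 - 2^-1 ^+ j).
  elim: j => [|j IH]; first by rewrite addn0 subrr ell_norm0 expr0 subrr mulr0.
  rewrite addnS -[u (k + j).+1](subrK (u (k + j)%N)) -addrA.
  apply: le_trans (ler_ell_normD _ _) _.
  apply: le_trans (lerD (hu _) IH) _.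
  rewrite -!exprVn exprD exprS; move: (2^-1 ^+ k) (2^-1 ^+ j) => q r.
  by rewrite le_eqVlt; apply/orP; left; apply/eqP; field.
have key k : exists2 f : L, (forall x, f x = h x - u k x) & ell_norm f <= 2 * c / 2 ^+ k.
  apply: restriction_normP; first by rewrite divr_ge0 ?mulr_ge0 ?exprn_ge0.
  move=> X; rewrite -subr_le0.
  apply: (@geometric_le0 _ _ (\sum_(y <- X) 4 * c)) => j; rewrite lerBlDr.
  have -> : restriction X (fun x => h x - u k x) =
      restriction X (fun x => h x - u (k + j)%N x) + restriction X (u (k + j)%N - u k).
    apply: ell_valE => x; rewrite [RHS]/(restriction _ _ x + restriction _ _ x) !restrictionE.
    case: ifP => _; last exact: (esym (addr0 (0 : R[i]))).
    change (h x - u k x = h x - u (k + j)%N x + (u (k + j)%N x - u k x)).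
    by rewrite addrA subrK.
  apply: le_trans (ler_ell_normD _ _) _; apply: lerD.
    apply: le_trans (restriction_norm_sum _ _) _; rewrite mulr_suml; apply: ler_sum => y _.
    apply: le_trans (hP y (k + j)%N) _; rewrite ler_wpM2l ?mulr_ge0//.
    by rewrite lef_pV2 ?posrE ?exprn_gt0// ler_weXn2l ?ler1n// leq_addl.
  apply: le_trans (restriction_norm_le _ _) _; apply: le_trans (tail k j) _.
  rewrite ler_piMr ?divr_ge0 ?mulr_ge0 ?exprn_ge0// gerBl exprn_ge0//.
have [f fE _] := key 0%N; exists (f + u 0%N) => k.
have [g gE gM] := key k; suff -> : f + u 0%N - u k = g by [].
apply: ell_valE => x; rewrite gE; have fx : (f x : R[i]) = h x - u 0%N x := fE x.
change ((f x : R[i]) + u 0%N x - u k x = h x - u k x); rewrite fx.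
by congr (_ - _); rewrite subrK.
Qed.

End ell_p_complete.

Section operators.
Context {R : realType} {T : choiceType} {p : R} {p1 : 1 <= p}.
Local Notation C := (R[i]^o).
Local Notation L := (ell T p1).
Local Notation B := (bop T p1).
Implicit Types (X : {fset T}) (F : B).

Let p0 : 0 < p. Proof. exact: lt_le_trans ltr01 p1. Qed.

Lemma opnorm0 : opnorm (0 : B) = 0.
Proof.
apply/eqP; rewrite eq_le opnorm_ge0 andbT; apply: opnorm_le => // f.
by rewrite mul0r (_ : (0 : B) f = 0) ?ell_norm0.
Qed.

Lemma opnorm_eq0 F : opnorm F = 0 -> F = 0.
Proof.
move=> F0; apply: val_inj; apply/funext => f; apply: ell_norm_eq0.
by apply/eqP; rewrite eq_le ell_norm_ge0 andbT (le_trans (opnormP F f))// F0 mul0r.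
Qed.

Lemma ler_opnormB F S : opnorm (F - S) <= opnorm F + opnorm S.
Proof.
apply: opnorm_le => [|f]; first by rewrite addr_ge0 ?opnorm_ge0.
rewrite mulrDl; apply: le_trans (ler_ell_normB (F f) (S f)) _.
by apply: lerD; exact: opnormP.
Qed.

Lemma normc_matrix_entry F x y : normc (matrix_entry F x y) <= opnorm F.
Proof.
apply: le_trans (normc_le_ell_norm _ _) _; apply: opnorm_ub.
exact: ell_norm_delta.
Qed.

Lemma bop_geometric_limit (u : nat -> B) c :
  (forall k, opnorm (u k.+1 - u k) <= c / 2 ^+ k) ->
  exists F : B, forall k, opnorm (F - u k) <= 2 * c / 2 ^+ k.
Proof.
move=> hu.
have c0 : 0 <= c by have := le_trans (opnorm_ge0 _) (hu 0%N); rewrite expr0 divr1.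
have /choice[Phi hPhi] : forall f : L, exists l : L, forall k,
    ell_norm (l - u k f) <= 2 * c / 2 ^+ k * ell_norm f.
  move=> f; have [k|l hl] := @ell_geometric_limit _ _ _ p1 (fun k => u k f) (c * ell_norm f).
    rewrite mulrAC; apply: le_trans (opnormP (u k.+1 - u k) f) _.
    by rewrite ler_wpM2r ?ell_norm_ge0.
  by exists l => k; apply: le_trans (hl k) _; rewrite mulrA mulrAC.
have lim_uniq (l l' : L) (K : R) :
    (forall k, ell_norm (l - l') <= K / 2 ^+ k) -> l = l'.
  move=> /geometric_le0 h; apply/eqP; rewrite -subr_eq0; apply/eqP/ell_norm_eq0.
  by apply/eqP; rewrite eq_le h ell_norm_ge0.
have linPhi : linear Phi.
  move=> a f g.
  apply: (lim_uniq _ _ (2 * c * (ell_norm (a *: f + g) + (normc a * ell_norm f + ell_norm g)))).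
  move=> k.
  have -> : Phi (a *: f + g) - (a *: Phi f + Phi g) = (Phi (a *: f + g) - u k (a *: f + g))
      - (a *: (Phi f - u k f) + (Phi g - u k g)).
    by rewrite (linearP (u k)) scalerBr [_ - _ + (_ - _)]addrACA -opprD opprB addrA subrK.
  apply: le_trans (ler_ell_normB _ _) _; rewrite mulrAC mulrDr; apply: lerD; first exact: hPhi.
  apply: le_trans (ler_ell_normD _ _) _; rewrite mulrDr; apply: lerD; last exact: hPhi.
  apply: le_trans (ell_normZ _ _) _; rewrite mulrCA; apply: ler_wpM2l; first exact: normc_ge0.
  exact: hPhi.
have bPhi : Phi \in @bop_pred R T p p1.
  apply/asboolP; split=> //; exists (2 * c + opnorm (u 0%N)) => f.
  rewrite -[Phi f](subrK (u 0%N f)) mulrDl; apply: le_trans (ler_ell_normD _ _) _.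
  by apply: lerD; [have := hPhi f 0%N; rewrite expr0 divr1|exact: opnormP].
exists (Bop bPhi) => k; apply: opnorm_le; first by rewrite divr_ge0 ?mulr_ge0 ?exprn_ge0.
by move=> f; exact: hPhi.
Qed.

(** The restriction to a finite set that almost exhausts the sum of the |f x|^p is close to
  f; this uses that p is finite. *)
Lemma ell_norm_tail (f : L) (e : R) : 0 < e ->
  exists X, forall Y, (X `<=` Y)%fset -> ell_norm (f - restriction p1 Y f) <= e.
Proof.
move=> e0.
pose g x := ((normc (f x) `^ p)%:E : \bar R).
have g0 x : (0 <= g x)%E by rewrite lee_fin powR_ge0.
have ep : 0 < e `^ p by exact: powR_gt0.
have [_ [A [finA _] <-] hA] := ub_ereal_sup_adherent ep (psum_fin f).
exists (fset_set A) => Y AY; apply: ell_norm_le; first exact: ltW.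
pose D : set T := [set` Y].
have AD : A `<=` D.
  by move=> x Ax; apply: (fsubsetP AY); rewrite in_fset_set// mem_set.
have hE : psum p f = (\esum_(x in D) g x + \esum_(x in ~` D) g x)%E.
  by rewrite [LHS](esumID D) ?setTI// => x _; exact: g0.
have -> : psum p (f - restriction p1 Y f) = (\esum_(x in ~` D) g x)%E.
  rewrite /psum (esumID D) ?setTI; last by move=> x _; rewrite lee_fin powR_ge0.
  have v x : (f - restriction p1 Y f) x = f x - (if x \in Y then f x else 0).
    by rewrite -(restrictionE p1).
  rewrite esum1 ?add0e.
    apply: eq_esum => x xD; rewrite v ifF ?subr0//.
    by apply/negP => xY; apply: xD.
  move=> x xD; rewrite v ifT// (_ : f x - f x = 0) ?subrr//.
  by rewrite ComplexField.Normc.normc0 powR0 ?gt_eqF.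
have DA : (\sum_(x \in A) g x <= \esum_(x in D) g x)%E.
  by apply: esum_ge; exists A.
have := psum_fin f; rewrite hE fin_numD => /andP[fa fb].
move: (lt_le_trans hA DA); rewrite -[ereal_sup _]/(psum p f) hE -(fineK fa) -(fineK fb).
by rewrite -EFinD lte_fin lee_fin; lra.
Qed.

(** Both sides are continuous in f and agree on the finitely supported functions, which are
  dense. *)
Lemma bop_finite_row F x X : (forall y, y \notin X -> matrix_entry F x y = 0) ->
  forall f : L, F f x = \sum_(y <- X) matrix_entry F x y * f y.
Proof.
move=> hX f; apply/eqP; rewrite -subr_eq0; apply/eqP/ComplexField.Normc.eq0_normc.
apply/eqP; rewrite eq_le normc_ge0 andbT; apply/ler_addgt0Pl => e e0; rewrite addr0.
pose M := opnorm F + 1.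
have M0 : 0 < M by rewrite ltr_wpDl ?opnorm_ge0.
have [Y hY] := ell_norm_tail f (divr_gt0 e0 M0).
have {}hY := hY (X `|` Y)%fset (fsubsetUr X Y).
set Z := (X `|` Y)%fset in hY *.
have -> : \sum_(y <- X) matrix_entry F x y * f y = F (restriction p1 Z f) x.
  rewrite /restriction raddf_sum ell_sum_val.
  rewrite [RHS](eq_bigr (fun y => matrix_entry F x y * (f y : R[i]))); last first.
    move=> y _; transitivity (((f y : R[i]) *: F (ell_delta p1 y)) x); last exact: mulrC.
    by congr (ell_val _ x); exact: linearZ.
  rewrite [RHS](bigID (mem X))/= [X in _ + X]big1 ?addr0; last first.
    by move=> y yX; rewrite hX ?mul0r.
  rewrite -[RHS]big_filter; apply: perm_big; apply: uniq_perm => //.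
    by rewrite filter_uniq.
  by move=> y; rewrite mem_filter inE; case: (y \in X).
have -> : F f x - F (restriction p1 Z f) x = F (f - restriction p1 Z f) x.
  by rewrite raddfB.
apply: le_trans (normc_le_ell_norm _ _) _; apply: le_trans (opnormP _ _) _.
apply: (@le_trans _ _ (M * (e / M))).
  by apply: ler_pM; rewrite ?opnorm_ge0 ?ell_norm_ge0// lerDl.
by rewrite mulrC divfK ?gt_eqF.
Qed.

(** Composition with a bijection is an isometry and multiplication by a bounded function is
  bounded: these are the operators out of which all finite-propagation ones are built. *)
Lemma weighted_composition (phi : T -> R[i]) (tau : T -> T) M : bijective tau ->
  (forall x, normc (phi x) <= M) ->
  exists F, forall (f : L) x, F f x = phi x * f (tau x).
Proof.
move=> tau_bij hM.
have [M0|M0] := lerP 0 M; last first.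
  by exists 0 => f x; have := le_lt_trans (normc_ge0 _) (le_lt_trans (hM x) M0); rewrite ltxx.
pose W0 (f : L) : T -> C := fun x => phi x * f (tau x).
have hp (f : L) : (psum p (W0 f) <= ((M * ell_norm f) `^ p)%:E)%E.
  rewrite powRM ?ell_norm_ge0// EFinM ell_norm_powR.
  have -> : psum p f = psum p (f \o tau : T -> C).
    by apply: reindex_esum; rewrite setTT_bijective.
  apply: le_trans (esumZ _ _); rewrite ?powR_ge0//; last by move=> x; exact: powR_ge0.
  apply: le_esum => x _; rewrite lee_fin ComplexField.Normc.normcM powRM ?normc_ge0//.
  rewrite ler_wpM2r ?powR_ge0// ge0_ler_powR ?nnegrE ?normc_ge0// ltW//.
have hL (f : L) : W0 f \in ell_pred T p1.
  by apply/asboolP; apply: le_lt_trans (hp f) _; exact: ltry.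
pose W (f : L) : L := Ell (hL f).
have bW : W \in @bop_pred R T p p1.
  apply/asboolP; split.
    move=> a f g; apply: ell_valE => x.
    change (phi x * (a * f (tau x) + g (tau x)) = a * (phi x * f (tau x)) + phi x * g (tau x)).
    by rewrite mulrDr mulrCA.
  exists M => f; apply: ell_norm_le; first by rewrite mulr_ge0 ?ell_norm_ge0.
  exact: hp.
by exists (Bop bW).
Qed.

End operators.

(** * The filtration by the operators preserving the cosets of G_ n *)

Section exhaustions.
Context {G : groupType} {G_ : nat -> set G} (GE : finite_exhaustion G_).

Lemma exhaustion1 n : G_ n 1%g.
Proof. by case: (exhaustion_subgroup GE n). Qed.

Lemma exhaustionM n x y : G_ n x -> G_ n y -> G_ n (x * y)%g.
Proof. by case: (exhaustion_subgroup GE n) => _ h _; exact: h. Qed.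

Lemma exhaustionV n x : G_ n x -> G_ n x^-1%g.
Proof. by case: (exhaustion_subgroup GE n) => _ _; apply. Qed.

Lemma exhaustionMl n x y : G_ n x -> G_ n (x * y)%g <-> G_ n y.
Proof.
move=> Gx; split=> [h|]; last exact: exhaustionM.
by rewrite -(mulKg x y); apply: exhaustionM => //; exact: exhaustionV.
Qed.

Lemma exhaustion_le m n : (m <= n)%N -> G_ m `<=` G_ n.
Proof.
move=> /subnK <-; elim: (n - m)%N => [|k IH]; first by rewrite add0n.
by rewrite addSn; apply: subset_trans IH _; exact: (exhaustion_incr GE).
Qed.

Lemma exhaustion_fset n x : (x \in fset_set (G_ n)) = `[< G_ n x >].
Proof. by rewrite in_fset_set ?inE//; exact: (exhaustion_finite GE). Qed.

Lemma exhaustion_fsetP n x : reflect (G_ n x) (x \in fset_set (G_ n)).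
Proof. by rewrite exhaustion_fset; exact: asboolP. Qed.

Lemma finite_sub_exhaustion (A : set G) : finite_set A -> exists n, A `<=` G_ n.
Proof.
move=> finA.
have /choice[k kP] : forall x, exists n, G_ n x.
  move=> x; have : (\bigcup_n G_ n) x by rewrite (exhaustion_cover GE).
  by case=> n _ h; exists n.
exists (\max_(x <- fset_set A) k x)%N => x Ax; apply: exhaustion_le (kP x).
by apply: leq_bigmax_seq => //; rewrite in_fset_set// mem_set.
Qed.

(** The coset x (G_ n) is represented by any of its elements x. *)
Definition coset_sum (V : nmodType) n (f : G -> V) (x : G) : V :=
  \sum_(h <- fset_set (G_ n)) f (x * h)%g.

Lemma coset_sumMr (V : nmodType) n (f : G -> V) x g : G_ n g ->
  coset_sum n f (x * g)%g = coset_sum n f x.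
Proof.
move=> Gg; rewrite /coset_sum; under eq_bigr do rewrite -mulgA.
rewrite -[LHS](big_map (fun h => g * h)%g xpredT (fun h => f (x * h)%g)).
apply: perm_big; apply: uniq_perm; rewrite ?fset_uniq//.
  by rewrite map_inj_uniq ?fset_uniq//; exact: mulgI.
move=> y; apply/mapP/idP => [[h hG ->]|/exhaustion_fsetP yG].
  by apply/exhaustion_fsetP/exhaustionM => //; apply/exhaustion_fsetP.
exists (g^-1 * y)%g; last by rewrite mulVKg.
by apply/exhaustion_fsetP/exhaustionM => //; exact: exhaustionV.
Qed.

Lemma coset_sum1 (V : nmodType) n (f : G -> V) x y : G_ n (x^-1 * y)%g ->
  (forall z, z != y -> f z = 0) -> coset_sum n f x = f y.
Proof.
move=> Gxy hf; rewrite /coset_sum (big_fsetD1 (x^-1 * y)%g); last exact/exhaustion_fsetP.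
rewrite mulVKg /= big1_fset ?addr0// => z; rewrite !inE => /andP[zy _] _; apply: hf.
by apply: contraNneq zy => <-; rewrite mulKg.
Qed.

Lemma coset_sum0 (V : nmodType) n (f : G -> V) x :
  (forall y, G_ n (x^-1 * y)%g -> f y = 0) -> coset_sum n f x = 0.
Proof.
move=> hf; rewrite /coset_sum big_seq big1// => h /exhaustion_fsetP Gh.
by apply: hf; rewrite mulKg.
Qed.

Lemma eq_coset_sum (V : nmodType) n (f g : G -> V) x :
  (forall y, G_ n (x^-1 * y)%g -> f y = g y) -> coset_sum n f x = coset_sum n g x.
Proof.
move=> fg; rewrite /coset_sum big_seq [RHS]big_seq; apply: eq_bigr => h /exhaustion_fsetP Gh.
by apply: fg; rewrite mulKg.
Qed.

End exhaustions.

Section filtration.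
Context {R : realType} {G : groupType} {p : R} {p1 : 1 <= p}.
Context {d : G -> G -> R} {dP : proper_left_invariant_metric d}.
Context {G_ : nat -> set G} (GE : finite_exhaustion G_).
Local Notation A := (roe p1 dP).
Local Notation L := (ell G p1).
Local Notation finite_propagation := (@finite_propagation R G p p1 d).
Implicit Types F S : A.

Definition roe_norm F : R := opnorm (roe_val F).

Definition entry F (x y : G) : R[i] := matrix_entry (roe_val F) x y.

Lemma entry1 x y : entry 1 x y = (x == y)%:R. Proof. by []. Qed.

Lemma entryB F S x y : entry (F - S) x y = entry F x y - entry S x y. Proof. by []. Qed.

Lemma entry_sum (I : Type) (r : seq I) (F : I -> A) x y :
  entry (\sum_(i <- r) F i) x y = \sum_(i <- r) entry (F i) x y.
Proof. by elim/big_ind2 : _ => // F1 a1 F2 a2 <- <-. Qed.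

Lemma normc_entry F x y : normc (entry F x y) <= roe_norm F.
Proof. exact: normc_matrix_entry. Qed.

Lemma roe_complete_norm : complete_ring_norm roe_norm.
Proof.
split.
- by move=> F; exact: opnorm_ge0.
- exact: opnorm0.
- by move=> F /opnorm_eq0 F0; exact: val_inj.
- by move=> F S; exact: ler_opnormB.
- by move=> F S; exact: opnormM.
- move=> u c hu; have [F hF] := bop_geometric_limit (u := fun k => roe_val (u k)) hu.
  suff FA : F \in roe_pred dP by exists (Roe FA).
  apply/asboolP => e e0; have e2 : 0 < e / 2 by rewrite divr_gt0.
  have [k hk] := geometric_small (2 * c) e2.
  have [S Sf hS] : exists2 S, finite_propagation S & opnorm (roe_val (u k) - S) < e / 2.
    by case: (u k) => /= U /asboolP; apply.
  exists S => //; have -> : F - S = (F - roe_val (u k)) - (0 - (roe_val (u k) - S)).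
    by rewrite sub0r opprK addrA subrK.
  apply: le_lt_trans (ler_opnormB _ _) _; rewrite [e]splitr; apply: ltrD.
    exact: le_lt_trans (hF k) hk.
  by apply: le_lt_trans (ler_opnormB _ _) _; rewrite opnorm0 add0r.
Qed.

(** The operators that preserve every coset x (G_ n), in terms of their matrices. *)
Definition stage n : set A := [set F | forall x y, entry F x y != 0 -> G_ n (x^-1 * y)%g].

Lemma stage_out n F x y : stage n F -> ~ G_ n (x^-1 * y)%g -> entry F x y = 0.
Proof. by move=> UF nG; apply/eqP; apply: contra_notT nG; exact: UF. Qed.

Lemma stage_apply n F (f : L) x : stage n F ->
  roe_val F f x = coset_sum (G_ := G_) n (fun y => entry F x y * (f y : R[i])) x.
Proof.
move=> UF; rewrite (@bop_finite_row _ _ _ _ _ x [fset (x * h)%g | h in fset_set (G_ n)]%fset).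
  by rewrite big_imfset//= => h k _ _ /mulgI.
move=> y yX; apply: (stage_out UF); apply: contraNnot yX => Gy.
by apply/imfsetP; exists (x^-1 * y)%g => /=; rewrite ?mulVKg//; apply/(exhaustion_fsetP GE).
Qed.

Lemma entryM n F S x z : stage n F ->
  entry (F * S) x z = coset_sum (G_ := G_) n (fun y => entry F x y * entry S y z) x.
Proof. by move=> UF; rewrite /entry -(stage_apply _ _ UF). Qed.

Lemma stage_eq n F S : stage n F -> stage n S ->
  (forall x y, entry F x y = entry S x y) -> F = S.
Proof.
move=> UF US FS; apply: val_inj; apply: val_inj; apply/funext => f; apply: ell_valE => x.
rewrite (stage_apply _ _ UF) (stage_apply _ _ US).
by apply: eq_bigr => h _; rewrite FS.
Qed.

Lemma stage_closed_subring n : closed_subring roe_norm (stage n).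
Proof.
split.
- move=> x y; rewrite entry1; have [->|] := eqVneq x y; last by rewrite eqxx.
  by rewrite mulVg => _; exact: (exhaustion1 GE).
- move=> F S UF US x y; apply: contra_neqP => nG.
  by rewrite entryB (stage_out UF nG) (stage_out US nG) subrr.
- move=> F S UF US x z; apply: contra_neqP => nG.
  rewrite (entryM _ _ _ UF); apply: (coset_sum0 GE) => y Gy.
  rewrite (stage_out (x := y) US) ?mulr0// => Gyz; apply: nG.
  by rewrite -[z](mulVKg y) mulgA; exact: (exhaustionM GE).
- move=> F hF x y; apply: contra_neqP => nG; apply: ComplexField.Normc.eq0_normc.
  apply/eqP; rewrite eq_le normc_ge0 andbT; apply/ler_addgt0Pl => e e0; rewrite addr0.
  have [S US FS] := hF e e0; rewrite -[entry F x y]subr0 -(stage_out US nG) -entryB.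
  exact: le_trans (normc_entry _ _ _) (ltW FS).
Qed.

Lemma stage_incr n : stage n `<=` stage n.+1.
Proof. by move=> F UF x y h; apply: (exhaustion_incr GE); exact: UF. Qed.

Lemma stage_finite_propagation n (F : bop G p1) :
  (forall x y, matrix_entry F x y != 0 -> G_ n (x^-1 * y)%g) -> finite_propagation F.
Proof.
move=> UF; apply/finite_propagationP.
exists (\sum_(h <- fset_set (G_ n)) d 1%g h) => x y /UF Gxy.
have -> : d x y = d 1%g (x^-1 * y)%g.
  by rewrite -(metric_left_invariant dP x^-1%g) mulVg.
rewrite (big_fsetD1 (x^-1 * y)%g)/= ?lerDl; last exact/(exhaustion_fsetP GE).
by apply: sumr_ge0 => h _; exact: (metric_ge0 dP).
Qed.

Lemma finite_propagation_roe (S : bop G p1) : finite_propagation S -> S \in roe_pred dP.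
Proof.
move=> Sf; apply/asboolP => e e0; exists S => //; rewrite subrr.
by rewrite opnorm0.
Qed.

(** The ball of radius r around the identity is finite, so it is contained in some G_ n, and
  a matrix entry at distance at most r is then an entry within a coset of G_ n. *)
Lemma stage_dense F e : 0 < e -> exists n S, stage n S /\ roe_norm (F - S) < e.
Proof.
move=> e0; have [S Sf FS] : exists2 S, finite_propagation S & opnorm (roe_val F - S) < e.
  by case: F => /= U /asboolP; apply.
have [r hr] := (proj1 (finite_propagationP S)) Sf.
have [n hn] := finite_sub_exhaustion GE (metric_proper dP 1%g r).
exists n, (Roe (finite_propagation_roe Sf)); split=> // x y /hr dxy; apply: hn => /=.
by rewrite -(mulVg x) (metric_left_invariant dP).
Qed.

(** The operator is the sum over h in G_ n of the right translations by h weighted by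
  K x (x h). *)
Lemma kernel_op n (K : G -> G -> R[i]) M : (forall x y, normc (K x y) <= M) ->
  (forall x y, K x y != 0 -> G_ n (x^-1 * y)%g) ->
  exists2 F, stage n F & forall x y, entry F x y = K x y.
Proof.
move=> KM KG.
have /choice[W WE] : forall h : G, exists W : bop G p1, forall (f : L) x,
    W f x = K x (x * h)%g * f (x * h)%g.
  move=> h; pose tau x := (x * h)%g.
  apply: (@weighted_composition _ _ _ _ (fun x => K x (x * h)%g) tau M) => //.
  by exists (fun x => x * h^-1)%g => x; rewrite /tau ?mulgK ?mulgVK.
pose S := \sum_(h <- fset_set (G_ n)) W h.
have SE x y : matrix_entry S x y = K x y.
  have -> : matrix_entry S x y = \sum_(h <- fset_set (G_ n)) matrix_entry (W h) x y.
    by rewrite /S; elim/big_ind2 : _ => // F1 a1 F2 a2 <- <-.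
  under eq_bigr do rewrite /matrix_entry WE.
  rewrite -/(coset_sum (G_ := G_) n (fun z => K x z * ell_delta p1 y z) x).
  have [Gxy|nG] := pselect (G_ n (x^-1 * y)%g).
    rewrite (coset_sum1 GE Gxy) => [|z zy]; rewrite [ell_delta _ _ _]/(_%:R) ?eqxx ?mulr1//.
    by rewrite (negPf zy) mulr0.
  rewrite (_ : K x y = 0); last by apply/eqP; apply: contra_notT nG; exact: KG.
  apply: (coset_sum0 GE) => z Gz; rewrite [ell_delta _ _ _]/(_%:R).
  by have [zy|] := eqVneq z y; rewrite ?mulr0//; rewrite zy in Gz.
have Sf : finite_propagation S.
  by apply: (@stage_finite_propagation n) => x y; rewrite SE; exact: KG.
by exists (Roe (finite_propagation_roe Sf)) => [x y|//]; rewrite /entry SE; exact: KG.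
Qed.

End filtration.

(** * Complex idempotent matrices *)

Section complex_idempotents.
Context {R : realType}.
Local Notation C := R[i].

Definition mx_bounded (M : R) m n (X : 'M[C]_(m, n)) := forall i j, normc (X i j) <= M.

Lemma mx_boundedM (M N : R) m n l (X : 'M_(m, n)) (Y : 'M_(n, l)) :
  mx_bounded M X -> mx_bounded N Y -> mx_bounded (n%:R * (M * N)) (X *m Y).
Proof.
move=> XM YN i j; rewrite mxE.
apply: (@le_trans _ _ (\sum_(k < n) normc (X i k * Y k j))).
  elim/big_rec2 : _ => [|k y x _ h]; first by rewrite ComplexField.Normc.normc0.
  by apply: le_trans (le_normcD _ _) _; rewrite lerD2l.
apply: (@le_trans _ _ (\sum_(k < n) M * N)); last by rewrite sumr_const card_ord mulr_natl.
apply: ler_sum => k _; rewrite ComplexField.Normc.normcM.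
by apply: ler_pM; rewrite ?normc_ge0.
Qed.

Lemma pid_mx_bounded m n r : mx_bounded 1 (pid_mx r : 'M_(m, n)).
Proof.
move=> i j; rewrite mxE; case: (_ && _); rewrite ?ComplexField.Normc.normc1//.
by rewrite ComplexField.Normc.normc0 ler01.
Qed.

Lemma unitarymx_bounded m n (S : 'M[C]_(m, n)) : S \is unitarymx -> mx_bounded 1 S.
Proof.
move=> /unitarymxP SS i j.
have Sii : (S *m S ^t*) i i = 1 by rewrite SS mxE eqxx.
rewrite mxE in Sii.
suff : `|S i j| <= 1 by rewrite -(lecR (normc _) 1).
rewrite -(@ler_pXn2r _ 2) ?nnegrE// expr1n -Sii (bigD1 j)//= !mxE.
rewrite -normCK lerDl; apply: sumr_ge0 => k _; rewrite !mxE -normCK.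
exact: exprn_ge0.
Qed.

Lemma mxtrace_pid n r : (r <= n)%N -> \tr (pid_mx r : 'M[C]_n) = r%:R.
Proof.
move=> rn; rewrite /mxtrace (eq_bigr (fun i : 'I_n => (i < r)%:R)) => [|i _]; last first.
  by rewrite mxE eqxx.
rewrite -natr_sum; congr _%:R.
rewrite (eq_bigr (fun i : 'I_n => if (i < r)%N then 1%N else 0%N)) => [|i _]; last by case: ifP.
by rewrite -big_mkcond -(big_ord_widen _ (fun=> 1%N) rn) sum_nat_const card_ord muln1.
Qed.

(** For S an orthonormal basis of the row space of e, e is the product of e S^t* and S, while
  S e S^t* is the identity of size the rank. The entries of S are at most 1, so the bounds on
  both factors depend on the size and on the bound of e only; this uniformity is what allows
  infinitely many blocks to be treated at once. The size l is a parameter in order to compare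
  idempotents of different sizes with the same coordinate projection. *)
Lemma idempotent_factor n l (M : R) (e : 'M[C]_n) : 0 <= M -> (n <= l)%N ->
  e *m e = e -> mx_bounded M e ->
  exists (v : 'M_(n, l)) (w : 'M_(l, n)), [/\ v *m w = e, w *m v = pid_mx (\rank e),
    mx_bounded (n%:R * (n%:R * M)) v & mx_bounded n%:R w].
Proof.
move=> M0 nl ee eM; set r := \rank e.
have rn : (r <= n)%N := rank_leq_col e.
have rl := leq_trans rn nl.
pose S := schmidt (row_base e).
have Su : S \is unitarymx by exact: schmidt_unitarymx.
have Se : (S :=: e)%MS.
  by apply: eqmx_trans (eqmx_schmidt_free (row_base_free e)) (eq_row_base e).
have SS : S *m S ^t* = 1%:M by exact/unitarymxP.
have eS : e *m S ^t* *m S = e.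
  have /submxP[x ex] : (e <= S)%MS by rewrite Se.
  have : x *m S *m S ^t* *m S = x *m S by rewrite -[x *m S *m _]mulmxA SS mulmx1.
  by rewrite -ex.
have Se1 : S *m e = S.
  have /submxP[y yE] : (S <= e)%MS by rewrite Se.
  by have : y *m e *m e = y *m e by [rewrite -mulmxA ee]; rewrite -yE.
exists (e *m S ^t* *m pid_mx r), (pid_mx r *m S); split.
- rewrite mulmxA -[_ *m pid_mx r *m pid_mx r]mulmxA mul_pid_mx minnn (minn_idPr rl).
  by rewrite pid_mx_1 mulmx1.
- rewrite !mulmxA -[_ *m S *m e]mulmxA Se1 -[_ *m S *m _]mulmxA SS mulmx1.
  by rewrite mul_pid_mx !minnn.
- have rM : r%:R <= n%:R :> R by rewrite ler_nat.
  have S1 : mx_bounded 1 (S ^t*).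
    move=> i j; rewrite !mxE; have := unitarymx_bounded Su j i.
    by case: (S j i) => a b /=; rewrite sqrrN.
  move=> i j; apply: le_trans (mx_boundedM (mx_boundedM eM S1) (@pid_mx_bounded _ _ r) i j) _.
  by rewrite !mulr1; apply: ler_wpM2r => //; rewrite mulr_ge0.
- move=> i j; apply: le_trans (mx_boundedM (@pid_mx_bounded _ _ r) (unitarymx_bounded Su) i j) _.
  by rewrite !mulr1 ler_nat.
Qed.

Lemma idempotent_trace n (e : 'M[C]_n) : e *m e = e -> \tr e = (\rank e)%:R.
Proof.
move=> ee; have e0 : mx_bounded (\sum_i \sum_j normc (e i j)) e.
  move=> i j; rewrite (bigD1 i)//= (bigD1 j)//= -addrA lerDl addr_ge0// sumr_ge0// => k _.
    exact: normc_ge0.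
  by rewrite sumr_ge0// => l _; exact: normc_ge0.
have M0 : 0 <= \sum_i \sum_j normc (e i j).
  by do 2![apply: sumr_ge0 => ? _]; exact: normc_ge0.
have [v [w [vw wv _ _]]] := idempotent_factor M0 (leqnn n) ee e0.
by rewrite -{1}vw mxtrace_mulC wv mxtrace_pid// rank_leq_row.
Qed.

End complex_idempotents.

(** * Reduction to diagonal projections *)

Section coset_representatives.
Context {G : groupType} {G_ : nat -> set G} (GE : finite_exhaustion G_) (n : nat).

Definition coset_rep (x : G) : G := xget 1%g [set y | G_ n (x^-1 * y)%g].

Lemma coset_repP x : G_ n (x^-1 * coset_rep x)%g.
Proof.
apply: (xgetPex 1%g (P := [set y | G_ n (x^-1 * y)%g])).
by exists x => /=; rewrite mulVg; exact: (exhaustion1 GE).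
Qed.

Lemma coset_repMr x g : G_ n g -> coset_rep (x * g)%g = coset_rep x.
Proof.
move=> Gg; congr xget; apply/seteqP; split=> y /=; rewrite invgM -mulgA.
  by move=> /(exhaustionMl GE)h; apply/h; exact: (exhaustionV GE).
by move=> h; apply/(exhaustionMl GE) => //; exact: (exhaustionV GE).
Qed.

Lemma coset_rep_eq x y : G_ n (x^-1 * y)%g -> coset_rep y = coset_rep x.
Proof. by move=> Gxy; rewrite -{1}(mulVKg x y) coset_repMr. Qed.

Lemma coset_repK x : coset_rep (coset_rep x) = coset_rep x.
Proof. exact: coset_rep_eq (coset_repP x). Qed.

Lemma coset_rep_sep x y : coset_rep x = coset_rep y -> G_ n (x^-1 * y)%g.
Proof.
move=> xy; rewrite -[y](mulVKg (coset_rep x)) mulgA; apply: (exhaustionM GE).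
  exact: coset_repP.
by rewrite xy -[y in (_ * y)%g]invgK -invgM; apply: (exhaustionV GE); exact: coset_repP.
Qed.

Fact coset_offset_subproof x : ((coset_rep x)^-1 * x)%g \in fset_set (G_ n).
Proof. by apply/(exhaustion_fsetP GE); apply: coset_rep_sep; rewrite coset_repK. Qed.

Definition coset_offset x : fset_set (G_ n) := [` coset_offset_subproof x]%fset.

Lemma coset_offsetE x (h : fset_set (G_ n)) : coset_rep x = x ->
  coset_offset (x * val h)%g = h.
Proof.
move=> xE; apply: val_inj => /=; rewrite coset_repMr ?xE ?mulKg//.
by apply/(exhaustion_fsetP GE); exact: valP.
Qed.

End coset_representatives.

Section diagonal_idempotents.
Context {R : realType} {G : groupType} {p : R} (p1 : 1 <= p).
Context {d : G -> G -> R} (dP : proper_left_invariant_metric d).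
Context {G_ : nat -> set G} (GE : finite_exhaustion G_).
Local Notation A := (roe p1 dP).
Local Notation stage := (@stage R G p p1 d dP G_).
Local Notation coset_sum := (@coset_sum G G_).
Local Notation mnorm := (@mnorm R A (@roe_norm R G p p1 d dP) _ _).

Lemma kernel_mx n m m' (K : 'I_m -> 'I_m' -> G -> G -> R[i]) M :
  (forall i j x y, normc (K i j x y) <= M) ->
  (forall i j x y, K i j x y != 0 -> G_ n (x^-1 * y)%g) ->
  exists2 X : 'M[A]_(m, m'), mx_in (stage n) X &
    forall i j x y, entry (X i j) x y = K i j x y.
Proof.
move=> KM KG.
have /fin_all_exists2[X UX XK] : forall ij : 'I_m * 'I_m', exists2 F : A, stage n F &
    forall x y, entry F x y = K ij.1 ij.2 x y.
  by move=> [i j] /=; exact: (kernel_op GE (KM i j) (KG i j)).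
exists (\matrix_(i, j) X (i, j)) => [i j|i j x y]; rewrite mxE; first exact: UX.
exact: XK.
Qed.

Lemma stage_mxP n m m' (X Y : 'M[A]_(m, m')) : mx_in (stage n) X -> mx_in (stage n) Y ->
  (forall i j x y, entry (X i j) x y = entry (Y i j) x y) -> X = Y.
Proof.
by move=> UX UY XY; apply/matrixP => i j; apply: (stage_eq GE (UX i j) (UY i j)).
Qed.

Lemma entry_mulmx n m m' m'' (X : 'M[A]_(m, m')) (Y : 'M[A]_(m', m'')) i j x z :
  mx_in (stage n) X -> entry ((X *m Y) i j) x z =
  \sum_l coset_sum n (fun y => entry (X i l) x y * entry (Y l j) y z) x.
Proof.
move=> UX; rewrite mxE entry_sum; apply: eq_bigr => l _.
exact: (entryM GE _ _ _ (UX i l)).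
Qed.

Section blocks.
Variable n : nat.
Local Notation Gn := (fset_set (G_ n)).
Local Notation index m := ('I_m * Gn)%type.

(** The block of X on the coset x (G_ n), in coordinates that depend on x within the coset. *)
Definition block m m' (X : 'M[A]_(m, m')) (x : G) : 'M[R[i]]_(#|{: index m}|, #|{: index m'}|) :=
  \matrix_(u, v) entry (X (enum_val u).1 (enum_val v).1)
    (x * val (enum_val u).2)%g (x * val (enum_val v).2)%g.

Lemma sum_index (m : nat) (F : 'I_m -> G -> R[i]) (x : G) :
  \sum_(u < #|{: index m}|) F (enum_val u).1 (x * val (enum_val u).2)%g =
  \sum_i coset_sum n (F i) x.
Proof.
transitivity (\sum_(u : index m) F u.1 (x * val u.2)%g).
  by rewrite -(big_enum_val (fun u : index m => F u.1 (x * val u.2)%g)); apply: eq_bigl.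
rewrite -(pair_bigA _ (fun i (h : Gn) => F i (x * val h)%g)) /=.
by apply: eq_bigr => i _; rewrite /coset_sum big_seq_fsetE.
Qed.

Lemma blockM m m' m'' (X : 'M[A]_(m, m')) (Y : 'M[A]_(m', m'')) x :
  mx_in (stage n) X -> block (X *m Y) x = block X x *m block Y x.
Proof.
move=> UX; apply/matrixP => u v; rewrite [LHS]mxE (entry_mulmx _ _ _ _ _ UX) [RHS]mxE.
under [RHS]eq_bigr do rewrite !mxE.
rewrite (sum_index (fun l y => entry (X (enum_val u).1 l) (x * val (enum_val u).2)%g y *
  entry (Y l (enum_val v).1) y (x * val (enum_val v).2)%g)).
apply: eq_bigr => l _; rewrite (coset_sumMr GE)//.
by apply/(exhaustion_fsetP GE); exact: valP.
Qed.

Lemma block_trace m (X : 'M[A]_m) x :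
  \tr (block X x) = \sum_i coset_sum n (fun y => entry (X i i) y y) x.
Proof. by rewrite /mxtrace -sum_index; apply: eq_bigr => u _; rewrite mxE. Qed.

Lemma block_bounded m m' (X : 'M[A]_(m, m')) x : mx_bounded (mnorm X) (block X x).
Proof.
move=> u v; rewrite mxE; apply: le_trans (normc_entry _ _ _) _.
exact: (le_mnorm (@roe_complete_norm R G p p1 d dP)).
Qed.

End blocks.

Section diagonal.
Variables (m : nat) (S : 'I_m -> G -> bool).

Fact diagonal_subproof : exists X : 'M[A]_m,
  forall i j x y, entry (X i j) x y = ([&& i == j, x == y & S i x])%:R.
Proof.
have [||X _ XE] := @kernel_mx 0 m m (fun i j x y => ([&& i == j, x == y & S i x])%:R) 1.
- move=> i j x y; case: [&& _, _ & _]; rewrite ?ComplexField.Normc.normc1//.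
  by rewrite ComplexField.Normc.normc0.
- move=> i j x y; have [->|] := eqVneq x y; last by rewrite andbF eqxx.
  by rewrite mulVg => _; exact: (exhaustion1 GE).
by exists X.
Qed.

Definition diagonal_mx : 'M[A]_m := sval (cid diagonal_subproof).

Lemma diagonalE i j x y : entry (diagonal_mx i j) x y = ([&& i == j, x == y & S i x])%:R.
Proof. exact: (svalP (cid diagonal_subproof)). Qed.

Lemma diagonal_stage n : mx_in (stage n) diagonal_mx.
Proof.
move=> i j x y; rewrite diagonalE; have [->|] := eqVneq x y; last by rewrite andbF eqxx.
by rewrite mulVg => _; exact: (exhaustion1 GE).
Qed.

Lemma diagonal_idem : diagonal_mx *m diagonal_mx = diagonal_mx.
Proof.
apply: (@stage_mxP 0); [|exact: diagonal_stage|].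
  apply: (mx_inM (stage_closed_subring GE 0)); exact: diagonal_stage.
move=> i j x z; rewrite (entry_mulmx _ _ _ _ _ (@diagonal_stage 0)).
rewrite (bigD1 i)//= [X in _ + X]big1 ?addr0 => [|l li]; last first.
  apply: (coset_sum0 GE) => y _; rewrite diagonalE eq_sym (negPf li); exact: mul0r.
rewrite (coset_sum1 GE (y := x)).
- rewrite !diagonalE !eqxx /=; by case: (S i x); rewrite ?mul1r ?mul0r ?andbF.
- by rewrite mulVg; exact: (exhaustion1 GE).
- by move=> y yx; rewrite diagonalE [x == y]eq_sym (negPf yx) andbF mul0r.
Qed.

End diagonal.

Lemma diagonal_trace n m (S : 'I_m -> G -> bool) x :
  \tr (block n (diagonal_mx S) x) = (coset_sum n (fun y => \sum_i S i y)%N x)%:R.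
Proof.
rewrite block_trace /coset_sum exchange_big natr_sum; apply: eq_bigr => h _ /=.
by rewrite natr_sum; apply: eq_bigr => i _; rewrite diagonalE !eqxx.
Qed.

End diagonal_idempotents.

Section classification.
Context {R : realType} {G : groupType} {p : R} (p1 : 1 <= p).
Context {d : G -> G -> R} (dP : proper_left_invariant_metric d).
Context {G_ : nat -> set G} (GE : finite_exhaustion G_).
Local Notation A := (roe p1 dP).
Local Notation stage := (@stage R G p p1 d dP G_).
Local Notation coset_sum := (@coset_sum G G_).
Local Notation mnorm := (@mnorm R A (@roe_norm R G p p1 d dP) _ _).
Local Notation coset_rep := (@coset_rep G G_).
Local Notation block n := (@block R G p p1 d dP G_ n _ _).
Local Notation diagonal_mx := (diagonal_mx p1 dP GE).

(** The idempotent is equivalent to a projection concentrated at the chosen representatives of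
  the cosets, with as many ones as the rank of the block. The equivalence is given by the
  factors of the blocks from [idempotent_factor], placed between the coset and its
  representative; their bound does not depend on the coset. *)
Lemma idempotent_diagonal n m (e : 'M[A]_m) l :
  mx_in (stage n) e -> e *m e = e -> (#|{: 'I_m * fset_set (G_ n)}| <= l)%N ->
  mvn_in (stage n) e
    (diagonal_mx (fun (k : 'I_l) x => (coset_rep n x == x) && (k < \rank (block n e x))%N)).
Proof.
move=> Ue ee ml; set D := #|_| in ml.
have M0 : 0 <= mnorm e := mnorm_ge0 (@roe_complete_norm R G p p1 d dP) e.
have be x : block n e x *m block n e x = block n e x by rewrite -(blockM GE)// ee.
have /choice[v /choice[w vw]] x := idempotent_factor M0 ml (be x) (@block_bounded R G p p1 d dP G_ n m m e x).
pose ix i x : 'I_D := enum_rank (i : 'I_m, coset_offset GE n x).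
pose K (i : 'I_m) (k : 'I_l) x y := if y == coset_rep n x then v y (ix i x) k else 0.
pose K' (k : 'I_l) (i : 'I_m) y x := if y == coset_rep n x then w y k (ix i x) else 0.
have [||X UX XE] := @kernel_mx _ _ _ p1 _ dP _ GE n _ _ K (D%:R * (D%:R * mnorm e)).
- move=> i k x y; rewrite /K; case: ifP => _; first by case: (vw y).
  by rewrite ComplexField.Normc.normc0 !mulr_ge0.
- move=> i k x y; rewrite /K; case: ifP => [/eqP-> _|]; last by rewrite eqxx.
  exact: coset_repP.
have [||Y UY YE] := @kernel_mx _ _ _ p1 _ dP _ GE n _ _ K' D%:R.
- move=> k i y x; rewrite /K'; case: ifP => _; first by case: (vw y).
  by rewrite ComplexField.Normc.normc0.
- move=> k i y x; rewrite /K'; case: ifP => [/eqP-> _|]; last by rewrite eqxx.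
  by apply: (coset_rep_sep GE); rewrite (coset_repK GE).
exists X, Y; split=> //.
- apply: (stage_mxP GE _ Ue); first exact: (mx_inM (stage_closed_subring GE n)).
  move=> i j x z; rewrite (entry_mulmx GE _ _ _ _ _ UX).
  rewrite (eq_bigr (fun k => K i k x (coset_rep n x) * K' k j (coset_rep n x) z)); last first.
    move=> k _; rewrite (coset_sum1 GE (y := coset_rep n x)) ?XE ?YE//; first exact: coset_repP.
    by move=> y yx; rewrite XE /K (negPf yx) mul0r.
  rewrite /K /K' eqxx; have [xz|xz] := eqVneq (coset_rep n x) (coset_rep n z).
    have [vwx _ _ _] := vw (coset_rep n x).
    have /matrixP/(_ (ix i x))/(_ (ix j z)) := vwx; rewrite !mxE => ->.
    by rewrite /ix !enum_rankK /= mulVKg xz mulVKg.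
  rewrite big1 => [|k _]; last by rewrite mulr0.
  by apply/esym/(stage_out (Ue i j)) => /(coset_rep_eq GE) zx; rewrite zx eqxx in xz.
apply: (stage_mxP GE); [exact: (mx_inM (stage_closed_subring GE n))|exact: diagonal_stage|].
move=> k k' y y'; rewrite (entry_mulmx GE _ _ _ _ _ UY) diagonalE.
have [yr|yr] := eqVneq (coset_rep n y) y; last first.
  rewrite !andbF big1// => i _; apply: (coset_sum0 GE) => x /(coset_rep_eq GE) xy.
  by rewrite YE /K' xy eq_sym (negPf yr) mul0r.
rewrite andTb.
have [yy|yy] := eqVneq y y'; last first.
  rewrite andbF big1// => i _; apply: (coset_sum0 GE) => x /(coset_rep_eq GE) xy.
  by rewrite XE /K xy yr eq_sym (negPf yy) mulr0.
rewrite andTb -{}yy.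
have [_ + _ _] := vw y; move=> /matrixP/(_ k)/(_ k'); rewrite !mxE => <-.
rewrite [RHS](eq_bigr (fun u : 'I_D => w y k (ix (enum_val u).1 (y * val (enum_val u).2)%g) *
   v y (ix (enum_val u).1 (y * val (enum_val u).2)%g) k')); last first.
  move=> u _; rewrite /ix (coset_offsetE GE)//.
  by rewrite -surjective_pairing enum_valK.
rewrite (sum_index n (fun i x => w y k (ix i x) * v y (ix i x) k')); apply: eq_bigr => i _.
apply: (eq_coset_sum GE) => x /(coset_rep_eq GE) xy.
by rewrite XE YE /K /K' xy yr eqxx.
Qed.

Local Open Scope quotient_scope.

Definition matrix_idempotent m (e : 'M[A]_m) (ee : e *m e = e) : Defs.idempotent A :=
  @Defs.Idempotent A (Tagged (fun n => 'M[A]_n) e) (introT eqP ee).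

Lemma mvn_in_class (U : set A) m m' (e : 'M[A]_m) (f : 'M[A]_m') ee ff : mvn_in U e f ->
  \pi_(mvn_class A) (@matrix_idempotent m e ee) = \pi_(mvn_class A) (@matrix_idempotent m' f ff).
Proof. by move=> [x [y [_ _ xy yx]]]; apply/eqmodP/mvn_eqvP; exists x, y. Qed.

Definition diagonal_class m (S : 'I_m -> G -> bool) : mvn_class A :=
  \pi_(mvn_class A) (matrix_idempotent (diagonal_idem p1 dP GE S)).

Definition multiplicity m (S : 'I_m -> G -> bool) (x : G) : nat := (\sum_i S i x)%N.

Lemma mvn_in_trace n m m' (e : 'M[A]_m) (f : 'M[A]_m') x :
  mvn_in (stage n) e f -> \tr (block n e x) = \tr (block n f x).
Proof.
by move=> [X [Y [UX UY <- <-]]]; rewrite !(blockM GE)// mxtrace_mulC.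
Qed.

(** The traces of the blocks of a diagonal projection are the coset sums of its multiplicity.
  By continuity an equivalence can be moved into some stage, which preserves the traces of
  blocks. Conversely the traces determine the ranks of the blocks, and by
  [idempotent_diagonal] the ranks determine the class. *)
Lemma diagonal_classP m m' (S : 'I_m -> G -> bool) (S' : 'I_m' -> G -> bool) :
  diagonal_class S = diagonal_class S' <->
  exists n, forall x, coset_sum n (multiplicity S) x = coset_sum n (multiplicity S') x.
Proof.
split=> [/eqmodP/mvn_eqvP[X [Y /= [XY YX]]]|[n SS']].
  have mvn : mvn_in setT (diagonal_mx S) (diagonal_mx S') by exists X, Y.
  have [n _ /mvn_in_trace h] := mvn_filtration (@roe_complete_norm R G p p1 d dP)
    (stage_closed_subring GE) (stage_incr GE) (stage_dense GE)
    (@diagonal_stage _ _ _ p1 _ dP _ GE _ S 0) (@diagonal_stage _ _ _ p1 _ dP _ GE _ S' 0)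
    (diagonal_idem p1 dP GE S) (diagonal_idem p1 dP GE S') mvn.
  exists n => x; have := h x; rewrite !diagonal_trace => /eqP; rewrite eqr_nat => /eqP.
  by [].
pose l := maxn #|{: 'I_m * fset_set (G_ n)}| #|{: 'I_m' * fset_set (G_ n)}|.
have E := idempotent_diagonal (@diagonal_stage _ _ _ p1 _ dP _ GE _ S n)
  (diagonal_idem p1 dP GE S) (leq_maxl _ _ : (_ <= l)%N).
have E' := idempotent_diagonal (@diagonal_stage _ _ _ p1 _ dP _ GE _ S' n)
  (diagonal_idem p1 dP GE S') (leq_maxr _ _ : (_ <= l)%N).
rewrite /diagonal_class (mvn_in_class _ (diagonal_idem p1 dP GE _) E).
rewrite (mvn_in_class _ (diagonal_idem p1 dP GE _) E').
suff rk x : \rank (block n (diagonal_mx S) x) = \rank (block n (diagonal_mx S') x).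
  suff -> : (fun (k : 'I_l) x => (coset_rep n x == x) && (k < \rank (block n (diagonal_mx S) x))%N) =
    (fun k x => (coset_rep n x == x) && (k < \rank (block n (diagonal_mx S') x))%N) by [].
  by apply/funext => k; apply/funext => x; rewrite rk.
apply/eqP; rewrite -(eqr_nat R[i]) -!idempotent_trace.
- by rewrite !diagonal_trace; have := SS' x; rewrite /multiplicity => ->.
- by rewrite -(blockM GE) ?diagonal_idem//; exact: diagonal_stage.
- by rewrite -(blockM GE) ?diagonal_idem//; exact: diagonal_stage.
Qed.

Lemma mvn_class_diagonal (u : mvn_class A) :
  exists m (S : 'I_m -> G -> bool), u = diagonal_class S.
Proof.
rewrite -[u]reprK; case: (repr u) => -[m e] he; have ee : e *m e = e := eqP he.
have [n [f [Uf ff ef]]] := idempotent_mvn_filtration (@roe_complete_norm R G p p1 d dP)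
    (stage_closed_subring GE) (stage_incr GE) (stage_dense GE) ee.
have fS := idempotent_diagonal Uf ff (leqnn _).
exists #|{: 'I_m * fset_set (G_ n)}|, (fun k x => (coset_rep n x == x) && (k < \rank (block n f x))%N).
rewrite /diagonal_class -(mvn_in_class ff _ fS) -(mvn_in_class ee ff ef).
by congr (\pi _); apply: val_inj.
Qed.

(** By [multiplicity_classP] this is the same class for every size N that bounds m. *)
Definition multiplicity_class N (m : G -> nat) : mvn_class A :=
  diagonal_class (fun (i : 'I_N) x => (i < m x)%N).

Lemma multiplicity_cut N (m : G -> nat) : (forall x, (m x <= N)%N) ->
  multiplicity (fun (i : 'I_N) x => (i < m x)%N) = m.
Proof.
move=> mN; apply/funext => x; rewrite /multiplicity.
rewrite (eq_bigr (fun i : 'I_N => if (i < m x)%N then 1%N else 0%N)) => [|i _]; last by case: ifP.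
by rewrite -big_mkcond -(big_ord_widen _ (fun=> 1%N) (mN x)) sum_nat_const card_ord muln1.
Qed.

Lemma multiplicity_le N (S : 'I_N -> G -> bool) x : (multiplicity S x <= N)%N.
Proof.
apply: (@leq_trans (\sum_(i < N) 1)%N); first by apply: leq_sum => i _; case: (S i x).
by rewrite sum_nat_const card_ord muln1.
Qed.

Lemma multiplicity_classP N N' (m m' : G -> nat) :
  (forall x, (m x <= N)%N) -> (forall x, (m' x <= N')%N) ->
  multiplicity_class N m = multiplicity_class N' m' <->
  exists n, forall x, coset_sum n m x = coset_sum n m' x.
Proof. by move=> mN mN'; rewrite /multiplicity_class diagonal_classP !multiplicity_cut. Qed.

Lemma mvn_class_multiplicity (u : mvn_class A) :
  exists N m, (forall x, (m x <= N)%N) /\ u = multiplicity_class N m.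
Proof.
have [N [S ->]] := mvn_class_diagonal u.
have h := @multiplicity_le N S; exists N, (multiplicity S); split=> //.
by apply/diagonal_classP; exists 0%N => x; rewrite multiplicity_cut.
Qed.

Definition diagonal_join m m' (S : 'I_m -> G -> bool) (S' : 'I_m' -> G -> bool)
    (i : 'I_(m + m')) : G -> bool :=
  match fintype.split i with inl a => S a | inr b => S' b end.

Lemma diagonal_joinl m m' (S : 'I_m -> G -> bool) (S' : 'I_m' -> G -> bool) i :
  diagonal_join S S' (lshift m' i) = S i.
Proof. by rewrite /diagonal_join -[lshift _ _]/(unsplit (inl i)) unsplitK. Qed.

Lemma diagonal_joinr m m' (S : 'I_m -> G -> bool) (S' : 'I_m' -> G -> bool) i :
  diagonal_join S S' (rshift m i) = S' i.
Proof. by rewrite /diagonal_join -[rshift _ _]/(unsplit (inr i)) unsplitK. Qed.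

Lemma diagonal_mx_join m m' (S : 'I_m -> G -> bool) (S' : 'I_m' -> G -> bool) :
  block_mx (diagonal_mx S) 0 0 (diagonal_mx S') = diagonal_mx (diagonal_join S S').
Proof.
have E i j x y : entry (block_mx (diagonal_mx S) 0 0 (diagonal_mx S') i j) x y =
    entry (diagonal_mx (diagonal_join S S') i j) x y.
  rewrite diagonalE; case: (split_ordP i) => a ->; case: (split_ordP j) => b ->.
  - by rewrite diagonal_joinl block_mxEul diagonalE eq_shift.
  - by rewrite block_mxEur mxE eq_shift.
  - by rewrite block_mxEdl mxE eq_shift.
  - by rewrite diagonal_joinr block_mxEdr diagonalE eq_shift.
apply: (@stage_mxP _ _ _ _ _ _ _ GE 0) => //; last exact: diagonal_stage.
by move=> i j x y; rewrite E; exact: (@diagonal_stage _ _ _ p1 _ dP _ GE _ _ 0).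
Qed.

Lemma diagonal_class_join m m' (S : 'I_m -> G -> bool) (S' : 'I_m' -> G -> bool) :
  diagonal_class (diagonal_join S S') = diagonal_class S + diagonal_class S'.
Proof.
rewrite -[RHS]/(mvn_add _ _) -pi_mvn_add /diagonal_class; congr (\pi _).
by apply: val_inj; rewrite /= diagonal_mx_join.
Qed.

Lemma multiplicity_classD N N' (m m' : G -> nat) :
  (forall x, (m x <= N)%N) -> (forall x, (m' x <= N')%N) ->
  multiplicity_class N m + multiplicity_class N' m' =
  multiplicity_class (N + N') (fun x => m x + m' x)%N.
Proof.
move=> mN mN'; rewrite -diagonal_class_join; apply/diagonal_classP; exists 0%N => x.
rewrite multiplicity_cut => [|y]; last exact: leq_add.
congr coset_sum; apply/funext => y; rewrite /multiplicity big_split_ord /=.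
under eq_bigr do rewrite diagonal_joinl.
under [X in (_ + X)%N]eq_bigr do rewrite diagonal_joinr.
congr (_ + _)%N; first exact: (congr1 (@^~ y) (multiplicity_cut mN)).
exact: (congr1 (@^~ y) (multiplicity_cut mN')).
Qed.

Lemma multiplicity_class1 :
  \pi_(mvn_class A) (idempotent1 A) = multiplicity_class 1 (fun=> 1%N).
Proof.
rewrite /multiplicity_class /diagonal_class; congr (\pi _); apply: val_inj => /=.
congr existT; apply: (@stage_mxP _ _ _ _ _ _ _ GE 0); last 1 first.
- move=> i j x y; rewrite diagonalE !ord1 mxE eqxx /= andbT; exact: entry1.
- exact: (mx_in1 (stage_closed_subring GE 0)).
- exact: diagonal_stage.
Qed.

End classification.

(** * Isomorphisms of K_0 triples *)

Section grothendieck_lift.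
Context {M : nmodType} {Q : zmodType} (phi : M -> Q).
Context (phiD : forall a b, phi (a + b) = phi a + phi b).
Local Open Scope quotient_scope.

Lemma groth_class_eq (a b : M) : groth_class a = groth_class b ->
  exists c, a + c = b + c.
Proof. by move=> /eqmodP/groth_eqvP[c /=]; rewrite !addr0; exists c. Qed.

Lemma groth_classD (a b : M) : groth_class (a + b) = groth_class a + groth_class b.
Proof. by rewrite -[RHS]/(groth_add _ _) /groth_class -pi_groth_add /= addr0. Qed.

Lemma groth_pi_sub (a b : M) : \pi_(groth M) (a, b) = groth_class a - groth_class b.
Proof.
rewrite -[RHS]/(groth_add _ (groth_opp _)) /groth_class -pi_groth_opp -pi_groth_add /=.
by rewrite addr0 add0r.
Qed.

Lemma groth_classB (u : groth M) : exists a b, u = groth_class a - groth_class b.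
Proof. by rewrite -[u]reprK; case: (repr u) => a b; exists a, b; rewrite groth_pi_sub. Qed.

Definition groth_lift (u : groth M) : Q := phi (repr u).1 - phi (repr u).2.

Lemma groth_lift_pi a b : groth_lift (\pi_(groth M) (a, b)) = phi a - phi b.
Proof.
rewrite /groth_lift; have /eqmodP/groth_eqvP[c] : repr (\pi_(groth M) (a, b)) = (a, b) %[mod groth M].
  by rewrite reprK.
move: (repr _) => [a' b'] /= E; apply/eqP; rewrite subr_eq addrAC eq_sym subr_eq eq_sym.
by apply/eqP/(addIr (phi c)); rewrite -!phiD E.
Qed.

Fact groth_lift_is_zmod_morphism : zmod_morphism groth_lift.
Proof.
move=> u v; rewrite -[u]reprK -[v]reprK; case: (repr u) (repr v) => [a b] [a' b'].
rewrite -[LHS]/(groth_lift (groth_add _ (groth_opp _))) -pi_groth_opp -pi_groth_add /=.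
by rewrite !groth_lift_pi !phiD opprD opprB addrACA.
Qed.

Lemma groth_lift_class a : groth_lift (groth_class a) = phi a.
Proof.
have phi0 : phi 0 = 0 by apply: (addIr (phi 0)); rewrite -phiD !add0r.
by rewrite groth_lift_pi phi0 subr0.
Qed.

Lemma groth_lift_bij : injective phi -> (forall q, exists a b, q = phi a - phi b) ->
  bijective groth_lift.
Proof.
move=> phiI gen.
have inj : injective groth_lift.
  move=> u v uv; apply/eqP; rewrite -subr_eq0.
  have [a [b E]] := groth_classB (u - v); rewrite E.
  have : groth_lift (u - v) = 0 by rewrite groth_lift_is_zmod_morphism uv subrr.
  rewrite E groth_lift_is_zmod_morphism !groth_lift_class => /eqP; rewrite subr_eq0 => /eqP/phiI ->.
  by rewrite subrr.
have /choice[g gK] : forall q, exists u, groth_lift u = q.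
  move=> q; have [a [b ->]] := gen q.
  by exists (groth_class a - groth_class b); rewrite groth_lift_is_zmod_morphism !groth_lift_class.
by exists g => [u|//]; apply: inj; rewrite gK.
Qed.

End grothendieck_lift.

(** The positive cone of K_0 is the image of the monoid of classes of idempotents, so an
  isomorphism of triples is determined by an embedding phi of this monoid whose image is the
  positive cone and generates the group. *)
Lemma K0_triple_iso (A : pzRingType) (T : triple) (phi : mvn_class A -> triple_group T) :
  (forall a b, phi (a + b) = phi a + phi b) -> injective phi ->
  (forall q, exists a b, q = phi a - phi b) ->
  range phi = @triple_pos T -> phi (\pi_(mvn_class A) (idempotent1 A))%qT = triple_unit T ->
  triple_iso (K0_triple A) T.
Proof.
move=> phiD phiI gen pos one.
pose f : {additive K0 A -> triple_group T} := HB.pack (groth_lift phi)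
  (GRing.isZmodMorphism.Build (groth (mvn_class A)) _ (groth_lift phi)
    (groth_lift_is_zmod_morphism phiD)).
exists f; split; first exact: groth_lift_bij.
  rewrite -pos; apply/seteqP; split => [_ [_ [e _ <-] <-]|_ [u _ <-]].
    by exists (\pi_(mvn_class A) e)%qT => //=; rewrite /K0_class groth_lift_class.
  exists (groth_class u); last exact: groth_lift_class.
  by exists (repr u) => //; rewrite /K0_class reprK.
by rewrite -one; exact: groth_lift_class.
Qed.

(** * Exhaustions and listings of the group *)

Section locally_finite_groups.
Context {G : groupType}.

Lemma smallest_subgroup (S : set G) : subgroup (smallest subgroup S).
Proof.
split=> [H [[]] //|x y Sx Sy H SH|x Sx H SH].
  by case: (SH) => -[_ HM _] _; apply: HM; [exact: Sx|exact: Sy].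
by case: (SH) => -[_ _ HV] _; apply: HV; exact: Sx.
Qed.

(** G_ n is generated by the elements numbered below n by an injection into the natural numbers. *)
Lemma finite_exhaustion_exists : countable [set: G] -> locally_finite G ->
  exists G_ : nat -> set G, finite_exhaustion G_.
Proof.
move=> /countable_injP[f fI] lfG.
pose S n := [set x : G | (f x < n)%N]; exists (fun n => smallest subgroup (S n)); split.
- apply/seteqP; split=> [x|_ ->]; last by case: (smallest_subgroup (S 0%N)).
  apply; split; last by [].
  by split=> [//|_ _ -> ->|_ ->]; rewrite ?mulg1 ?invg1.
- by move=> n; exact: smallest_subgroup.
- move=> n; apply: lfG; apply: (@finite_preimage _ _ `I_n f) => //.
  by move=> x y _ _; apply: fI; rewrite inE.
- move=> n; apply: smallest_sub; first exact: smallest_subgroup.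
  move=> x Sx; apply: sub_gen_smallest; exact: ltnW.
- apply/seteqP; split=> // x _; exists (f x).+1 => //.
  by apply: sub_gen_smallest; rewrite /S /=.
Qed.

End locally_finite_groups.

Lemma nth_allpairs (S T U : Type) (f : S -> T -> U) (s : seq S) (t : seq T) x0 y0 z0 q r :
  (q < size s)%N -> (r < size t)%N ->
  nth z0 [seq f x y | x <- s, y <- t] (q * size t + r) = f (nth x0 s q) (nth y0 t r).
Proof.
elim: s q => [//|x s IH] [|q] /= qs rt; rewrite nth_cat size_map.
  by rewrite mul0n add0n rt (nth_map y0).
by rewrite mulSn -addnA ltnNge leq_addr /= addKn IH.
Qed.

Section enumeration.
Context {G : groupType} {G_ : nat -> set G} (GE : finite_exhaustion G_).
Local Notation k := (exhaustion_card G_).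
Local Notation coset_rep := (@coset_rep G G_).
Local Notation coset_sum := (@coset_sum G G_).

(** Representatives of the left cosets of G_ n in G_ n.+1. That of G_ n itself is 1 and comes
  first, so that each of the enumerations below is a prefix of the next. *)
Definition transversal n : seq G :=
  1%g :: [seq x <- fset_set (G_ n.+1) | (x \notin fset_set (G_ n)) && (coset_rep n x == x)].

Fixpoint enumeration n : seq G :=
  if n is n'.+1 then [seq (t * x)%g | t <- transversal n', x <- enumeration n'] else [:: 1%g].

Lemma mem_enumeration n y : (y \in enumeration n) = (y \in fset_set (G_ n)).
Proof.
elim: n y => [|n IH] y.
  rewrite inE; apply/eqP/(exhaustion_fsetP GE); rewrite (exhaustion0 GE); first by move=> ->.
  by [].
apply/allpairsP/(exhaustion_fsetP GE) => [[[t x]] /= [tT]|Gy].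
  rewrite IH => /(exhaustion_fsetP GE)/(exhaustion_incr GE) Gx ->.
  apply: (exhaustionM GE) => //; move: tT; rewrite inE mem_filter => /orP[/eqP->|].
    exact: (exhaustion1 GE).
  by move=> /andP[_ /(exhaustion_fsetP GE)].
have [Gny|nGny] := boolP (y \in fset_set (G_ n)).
  by exists (1%g, y); rewrite mem_head IH Gny mul1g.
have Gr : G_ n (y^-1 * coset_rep n y)%g by exact: coset_repP.
exists (coset_rep n y, (coset_rep n y)^-1 * y)%g; split=> /=; last by rewrite mulVKg.
  rewrite inE mem_filter (coset_repK GE) eqxx andbT; apply/orP; right; apply/andP; split.
    apply: contra nGny => /(exhaustion_fsetP GE) h; apply/(exhaustion_fsetP GE).
    rewrite -[y](mulVKg (coset_rep n y)); apply: (exhaustionM GE) => //.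
    by rewrite -[y in (_ * y)%g]invgK -invgM; exact: (exhaustionV GE).
  apply/(exhaustion_fsetP GE); rewrite -[coset_rep n y](mulVKg y).
  by apply: (exhaustionM GE) => //; exact: (exhaustion_incr GE).
rewrite IH; apply/(exhaustion_fsetP GE).
by rewrite -[y in (_ * y)%g]invgK -invgM; exact: (exhaustionV GE).
Qed.

Lemma transversal_inj n t t' : t \in transversal n -> t' \in transversal n ->
  G_ n (t^-1 * t')%g -> t = t'.
Proof.
rewrite !inE !mem_filter => /orP[/eqP->|/andP[/andP[nt /eqP rt] _]]
    /orP[/eqP->|/andP[/andP[nt' /eqP rt'] _]] //.
- by rewrite invg1 mul1g => /(exhaustion_fsetP GE); rewrite (negPf nt').
- rewrite mulg1 => /(exhaustionV GE); rewrite invgK => /(exhaustion_fsetP GE).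
  by rewrite (negPf nt).
- by move=> /(coset_rep_eq GE); rewrite rt rt'.
Qed.

Lemma enumeration_uniq n : uniq (enumeration n).
Proof.
elim: n => [//|n IH]; apply: allpairs_uniq => //.
  rewrite /= filter_uniq ?fset_uniq// andbT mem_filter negb_and.
  by rewrite (introT (exhaustion_fsetP GE n _) (exhaustion1 GE n)).
move=> u v uE vE; have [[t x] /= [tT xE ->]] := allpairsP uE.
have [[t' x'] /= [tT' xE' ->]] := allpairsP vE => /= E.
have tt : t = t'.
  apply: (transversal_inj tT tT'); have -> : (t^-1 * t')%g = (x * x'^-1)%g.
    by rewrite -[t'](mulgK x') -E !mulgA mulVg mul1g.
  move: xE xE'; rewrite !mem_enumeration => /(exhaustion_fsetP GE) Gx /(exhaustion_fsetP GE) Gx'.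
  by apply: (exhaustionM GE) => //; exact: (exhaustionV GE).
by move: E; rewrite tt => /mulgI ->.
Qed.

Lemma size_enumeration n : size (enumeration n) = k n.
Proof.
apply/perm_size/uniq_perm; rewrite ?enumeration_uniq ?fset_uniq// => x.
exact: mem_enumeration.
Qed.

Lemma exhaustion_card_gt0 n : (0 < k n)%N.
Proof.
rewrite -size_enumeration -has_predT; apply/hasP; exists 1%g => //.
by rewrite mem_enumeration; apply/(exhaustion_fsetP GE); exact: (exhaustion1 GE).
Qed.

Lemma exhaustion_cardS n : k n.+1 = (size (transversal n) * k n)%N.
Proof. by rewrite -!size_enumeration size_allpairs. Qed.

Lemma nth_enumerationS n q r : (q < size (transversal n))%N -> (r < k n)%N ->
  nth 1%g (enumeration n.+1) (q * k n + r) =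
  (nth 1%g (transversal n) q * nth 1%g (enumeration n) r)%g.
Proof. by move=> qs rk; rewrite -{1}size_enumeration; apply: nth_allpairs; rewrite ?size_enumeration. Qed.

Lemma nth_enumeration_le m n i : (m <= n)%N -> (i < k m)%N ->
  nth 1%g (enumeration n) i = nth 1%g (enumeration m) i.
Proof.
move=> /subnK <-; elim: (n - m)%N => [//|l IH] im.
have kl : (k m <= k (l + m))%N.
  by rewrite dvdn_leq ?exhaustion_card_gt0// (exhaustion_card_dvd GE)// leq_addl.
rewrite -IH// addSn; have := @nth_enumerationS (l + m) 0 i isT (leq_trans im kl).
by rewrite mul0n add0n /= mul1g.
Qed.

Context (G_infinite : infinite_set [set: G]).

Lemma exhaustion_card_unbounded i : exists n, (i < k n)%N.
Proof.
have [B _ iB] := infinite_set_fset i.+1 G_infinite.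
have [n Bn] := finite_sub_exhaustion GE (finite_fset B).
exists n; apply: leq_trans iB _; apply: fsubset_leq_card; apply/fsubsetP => x xB.
by apply/(exhaustion_fsetP GE); exact: Bn.
Qed.

Definition position_stage i : nat := sval (cid (exhaustion_card_unbounded i)).

Lemma position_stageP i : (i < k (position_stage i))%N.
Proof. exact: (svalP (cid (exhaustion_card_unbounded i))). Qed.

(** The common extension of the enumerations. *)
Definition listing (i : nat) : G := nth 1%g (enumeration (position_stage i)) i.

Lemma listingE n i : (i < k n)%N -> listing i = nth 1%g (enumeration n) i.
Proof.
move=> ik; rewrite /listing; set l := position_stage i.
have il : (i < k l)%N by exact: position_stageP.
by case: (leqP l n) => h; [rewrite (nth_enumeration_le h)|rewrite (nth_enumeration_le (ltnW h))].
Qed.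

Lemma listing_stage n : perm_eq [seq listing i | i <- iota 0 (k n)] (fset_set (G_ n)).
Proof.
have -> : [seq listing i | i <- iota 0 (k n)] = enumeration n.
  rewrite -[RHS](mkseq_nth 1%g) /mkseq size_enumeration; apply/eq_in_map => i.
  by rewrite mem_iota => /listingE.
apply: uniq_perm; rewrite ?enumeration_uniq ?fset_uniq// => x.
exact: mem_enumeration.
Qed.

Lemma listing_bij : bijective listing.
Proof.
have surj x : exists i, listing i = x.
  have [n Gx] := finite_sub_exhaustion GE (finite_set1 x).
  have : x \in fset_set (G_ n) by apply/(exhaustion_fsetP GE); exact: Gx.
  by rewrite -(perm_mem (listing_stage n)) => /mapP[i _ ->]; exists i.
have inj : injective listing.
  move=> i j; wlog ij : i j / (i <= j)%N.
    by move=> wl; case: (leqP i j) => [|/ltnW] h E; [exact: wl|apply/esym/wl].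
  have jk := position_stageP j; have ik := leq_ltn_trans ij jk.
  rewrite (listingE ik) (listingE jk) => /eqP.
  by rewrite nth_uniq ?size_enumeration ?enumeration_uniq// => /eqP.
have /choice[g gK] := surj.
by exists g => [i|//]; apply: inj; rewrite gK.
Qed.

Lemma listing_step n q r : (q < size (transversal n))%N -> (r < k n)%N ->
  listing (q * k n + r) = (nth 1%g (transversal n) q * listing r)%g.
Proof.
move=> qs rk; rewrite (listingE rk) -nth_enumerationS// -listingE//.
rewrite exhaustion_cardS; apply: (@leq_trans (q.+1 * k n)); last by rewrite leq_mul2r qs orbT.
by rewrite mulSn addnC ltn_add2r.
Qed.

(** Within a block of length k n the listing runs through G_ n translated by the first
  element of the block, so the block is a coset. The induction is on a stage N that
  contains the block: an element of a later stage is a representative times an element that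
  comes before, and k n divides k N, so that blocks do not straddle representatives. *)
Lemma listing_block n j r : (r < k n)%N ->
  listing (j * k n + r) = (listing (j * k n) * listing r)%g.
Proof.
have [N] := exhaustion_card_unbounded (j * k n + r); move=> + rk.
have [Nn jN|nN] := leqP N n.
  have : (j * k n + r < k n)%N.
    apply: leq_trans jN _; rewrite dvdn_leq ?exhaustion_card_gt0//.
    exact: (exhaustion_card_dvd GE).
  case: j jN => [|j] _; last by rewrite mulSn -addnA ltnNge leq_addr.
  rewrite mul0n add0n (_ : listing 0 = 1%g) ?mul1g// (listingE (exhaustion_card_gt0 0)).
  by [].
move: nN => /ltnW/subnK <-; elim: (N - n)%N j => [|l IH] j.
  rewrite add0n; case: j => [|j] ; last by rewrite mulSn -addnA ltnNge leq_addr.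
  move=> _; rewrite mul0n add0n (_ : listing 0 = 1%g) ?mul1g//.
  exact: (listingE (exhaustion_card_gt0 0)).
rewrite addSn exhaustion_cardS => jk.
have /dvdnP[c cE] : (k n %| k (l + n))%N by apply: (exhaustion_card_dvd GE); rewrite leq_addl.
have c0 : (0 < c)%N.
  by have := exhaustion_card_gt0 (l + n); rewrite cE muln_gt0 => /andP[].
have jc : (j %% c < c)%N by rewrite ltn_mod.
have E u : (j * k n + u = j %/ c * k (l + n) + (j %% c * k n + u))%N.
  by rewrite cE mulnA addnA -mulnDl -divn_eq.
have lt u : (u < k n)%N -> (j %% c * k n + u < k (l + n))%N.
  move=> un; rewrite cE; apply: (@leq_trans ((j %% c).+1 * k n)).
    by rewrite mulSn addnC ltn_add2r.
  by rewrite leq_mul2r jc orbT.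
have qs : (j %/ c < size (transversal (l + n)))%N.
  rewrite -(ltn_pmul2r (exhaustion_card_gt0 (l + n))).
  by apply: leq_ltn_trans jk; rewrite E leq_addr.
have E0 := E 0%N; rewrite addn0 in E0.
have lt0 := lt 0%N (exhaustion_card_gt0 n); rewrite addn0 in lt0.
rewrite E E0 addn0 (listing_step qs (lt r rk)) (listing_step qs lt0).
by rewrite IH ?lt// mulgA.
Qed.

Lemma listing_block_sum (V : nmodType) n j (f : G -> V) :
  \sum_(j * k n <= i < j.+1 * k n) f (listing i) = coset_sum n f (listing (j * k n)).
Proof.
rewrite /coset_sum -(perm_big _ (listing_stage n)) /= big_map.
rewrite mulSn -{1}[(j * k n)%N]add0n big_addn addnK -/(index_iota 0 (k n)).
rewrite /index_iota subn0 big_seq [RHS]big_seq; apply: eq_bigr => r.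
by rewrite mem_iota => /andP[_ rk]; rewrite addnC listing_block.
Qed.

Lemma coset_sum_listing (V : nmodType) n (f : G -> V) :
  (forall x, coset_sum n f x = 0) <->
  (forall j, \sum_(j * k n <= i < j.+1 * k n) f (listing i) = 0).
Proof.
split=> [h j|h x]; first by rewrite listing_block_sum.
have [g _ gK] := listing_bij; rewrite -[x]gK (divn_eq (g x) (k n)).
have rk : (g x %% k n < k n)%N by rewrite ltn_mod exhaustion_card_gt0.
rewrite listing_block// (coset_sumMr GE) -?listing_block_sum//.
apply/(exhaustion_fsetP GE); rewrite -(perm_mem (listing_stage n)).
by apply/mapP; exists (g x %% k n)%N; rewrite // mem_iota.
Qed.

End enumeration.

(** * The computation of K_0 *)

Lemma coset_sumD (G : groupType) (G_ : nat -> set G) (V : nmodType) n (f g : G -> V) x :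
  coset_sum (G_ := G_) n (fun y => f y + g y) x =
  coset_sum (G_ := G_) n f x + coset_sum (G_ := G_) n g x.
Proof. exact: big_split. Qed.

Section bounded_sequences.
Context {G : groupType} {G_ : nat -> set G} (GE : finite_exhaustion G_).
Context (G_infinite : infinite_set [set: G]).
Local Notation coset_sum := (@coset_sum G G_).
Local Notation listing := (listing GE G_infinite).

Definition bounded_multiplicity (m : G -> nat) := exists N, forall x, (m x <= N)%N.

Fact listing_seq_subproof m : bounded_multiplicity m ->
  (fun i => (m (listing i))%:Z) \in linf_pred.
Proof. by move=> [N mN]; apply/asboolP; exists N%:Z => i; rewrite lez_nat mN. Qed.

Definition listing_seq m (h : bounded_multiplicity m) : linf := Linf (listing_seq_subproof h).

Lemma linf_quot_classP (a b : linf) : linf_quot_class GE a = linf_quot_class GE b <->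
  exists n, H_n G_ n (a - b).
Proof.
have -> : (linf_quot_class GE a = linf_quot_class GE b) <-> a - b \in H_pred GE.
  by rewrite Quotient.idealrBE; split=> [h|/eqP//]; exact/eqP.
by split=> [/asboolP[n _ h]|[n h]]; [exists n|apply/asboolP; exists n].
Qed.

Lemma listing_seqP m m' (h : bounded_multiplicity m) (h' : bounded_multiplicity m') :
  linf_quot_class GE (listing_seq h) = linf_quot_class GE (listing_seq h') <->
  exists n, forall x, coset_sum n m x = coset_sum n m' x.
Proof.
rewrite linf_quot_classP; pose f x : int := (m x)%:Z - (m' x)%:Z.
have E n x : coset_sum n f x = (coset_sum n m x)%:Z - (coset_sum n m' x)%:Z.
  by rewrite /coset_sum sumrB !(big_morph Posz PoszD (erefl (Posz 0))).
split=> -[n nP]; exists n.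
  move=> x; have /(_ x) : forall x, coset_sum n f x = 0 by apply/coset_sum_listing.
  by rewrite E => /eqP; rewrite subr_eq0 => /eqP[].
by apply/(coset_sum_listing GE G_infinite n f) => x; rewrite E nP subrr.
Qed.

Lemma linf_listing_seq (z : linf) : (forall i, 0 <= z i) ->
  exists m (h : bounded_multiplicity m), z = listing_seq h.
Proof.
move=> z0; have [g gK Kg] := listing_bij GE G_infinite.
have [M hM] : exists M : int, forall i, `|z i| <= M by case: z {z0} => z /= /asboolP.
have h : bounded_multiplicity (fun x => `|z (g x)|%N).
  by exists `|M|%N => x; rewrite -lez_nat !abszE (le_trans (hM _))// ler_norm.
exists (fun x => `|z (g x)|%N), h; apply: val_inj; apply/funext => i /=.
by rewrite gK gez0_abs.
Qed.

Lemma linf_quot_classD (a b : linf) :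
  linf_quot_class GE (a + b) = linf_quot_class GE a + linf_quot_class GE b.
Proof. exact: Quotient.pi_add. Qed.

(** A bounded sequence becomes nonnegative when a large constant is added. *)
Lemma linf_quot_classB (q : linf_quot GE) : exists m m' (h : bounded_multiplicity m)
  (h' : bounded_multiplicity m'),
  q = linf_quot_class GE (listing_seq h) - linf_quot_class GE (listing_seq h').
Proof.
rewrite -[q]reprK; set z := repr q.
have [M hM] : exists M : int, forall i, `|z i| <= M by case: (z) => z' /= /asboolP.
have M0 : 0 <= M by exact: le_trans (normr_ge0 _) (hM 0%N).
have cM : (fun=> M) \in linf_pred by apply/asboolP; exists M => i; rewrite ger0_norm.
have [m' [h' E']] := linf_listing_seq (z := Linf cM) (fun=> M0).
have [|m [h E]] := linf_listing_seq (z := z + Linf cM).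
  by move=> i; rewrite [X in _ <= X]/(z i + M) -lerBlDr sub0r; have := hM i; rewrite ler_norml => /andP[].
by exists m, m', h, h'; rewrite -E -E' linf_quot_classD addrK.
Qed.

End bounded_sequences.

Section main.
Context {R : realType} {G : groupType} {d : G -> G -> R}.
Context (dP : proper_left_invariant_metric d).
Context {G_ : nat -> set G} (GE : finite_exhaustion G_).
Local Notation coset_sum := (@coset_sum G G_).

(** The embedding sends the class of multiplicity m to the class of m read along the listing:
  [multiplicity_classP] and [listing_seqP] describe equality on both sides in the same way. *)
Lemma K0_roe_linf (p : R) (p1 : 1 <= p) : infinite_set [set: G] ->
  triple_iso (K0_triple (roe p1 dP)) (linf_triple GE).
Proof.
move=> Ginf; have /choice[N /choice[m hm]] := @mvn_class_multiplicity R G p p1 d dP G_ GE.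
have bm u : bounded_multiplicity (m u) by exists (N u); case: (hm u).
pose phi u : linf_quot GE := linf_quot_class GE (listing_seq GE Ginf (bm u)).
have phiP u m' N' (h' : forall x, (m' x <= N')%N) (b' : bounded_multiplicity m') :
    u = multiplicity_class p1 dP GE N' m' -> phi u = linf_quot_class GE (listing_seq GE Ginf b').
  move=> uE; have [mN uE'] := hm u; apply/listing_seqP.
  by apply/(@multiplicity_classP R G p p1 d dP G_ GE _ _ _ _ mN h'); rewrite -uE'.
have phi_surj m' (b' : bounded_multiplicity m') :
    exists u, phi u = linf_quot_class GE (listing_seq GE Ginf b').
  by have [N' h'] := b'; exists (multiplicity_class p1 dP GE N' m'); exact: (phiP _ _ N').
apply: (@K0_triple_iso _ (linf_triple GE) phi).
- move=> a b; have [aN aE] := hm a; have [bN bE] := hm b.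
  have b' : bounded_multiplicity (fun x => m a x + m b x)%N.
    by exists (N a + N b)%N => x; exact: leq_add.
  rewrite (phiP (a + b) _ (N a + N b)%N _ b'); last by rewrite {1}aE {1}bE multiplicity_classD.
    by rewrite -linf_quot_classD; congr linf_quot_class; apply: val_inj; apply/funext => i.
  by move=> x; exact: leq_add.
- move=> a b; have [aN aE] := hm a; have [bN bE] := hm b => /listing_seqP ab.
  by rewrite aE bE; apply/multiplicity_classP.
- move=> q; have [m1 [m2 [h1 [h2 ->]]]] := linf_quot_classB Ginf q.
  by have [a <-] := phi_surj _ h1; have [b <-] := phi_surj _ h2; exists a, b.
- apply/seteqP; split=> [_ [u _ <-]|_ [z z0 <-]]; first by exists (listing_seq GE Ginf (bm u)).
  have [m' [b' ->]] := linf_listing_seq GE Ginf z0.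
  by have [u uE] := phi_surj _ b'; exists u.
- have b1 : bounded_multiplicity (fun _ : G => 1%N) by exists 1%N.
  rewrite (phiP _ _ 1%N _ b1) => [|//|]; last exact: multiplicity_class1.
  by congr linf_quot_class; apply: val_inj.
Qed.

(** Matching the classes with the same multiplicity for the two exponents is well defined and
  injective, as the condition of [multiplicity_classP] involves neither. Coset sums of natural
  numbers cancel, so the monoid of classes for q embeds in its Grothendieck group. *)
Lemma K0_roe_exponent (p q : R) (p1 : 1 <= p) (q1 : 1 <= q) :
  triple_iso (K0_triple (roe p1 dP)) (K0_triple (roe q1 dP)).
Proof.
have /choice[N /choice[m hm]] := @mvn_class_multiplicity R G p p1 d dP G_ GE.
pose psi u := multiplicity_class q1 dP GE (N u) (m u).
have psiP u m' N' (h' : forall x, (m' x <= N')%N) :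
    u = multiplicity_class p1 dP GE N' m' -> psi u = multiplicity_class q1 dP GE N' m'.
  move=> uE; have [mN uE'] := hm u; apply/multiplicity_classP => //.
  by apply/(@multiplicity_classP R G p p1 d dP G_ GE _ _ _ _ mN h'); rewrite -uE'.
have psi_surj v : exists u, psi u = v.
  have [N' [m' [h' ->]]] := @mvn_class_multiplicity R G q q1 d dP G_ GE v.
  by exists (multiplicity_class p1 dP GE N' m'); exact: psiP.
apply: (@K0_triple_iso _ (K0_triple (roe q1 dP)) (fun u => groth_class (psi u))).
- move=> a b; rewrite -groth_classD; congr groth_class.
  have [aN aE] := hm a; have [bN bE] := hm b.
  by rewrite multiplicity_classD//; apply: psiP => [x|]; [exact: leq_add|rewrite {1}aE {1}bE multiplicity_classD].
- move=> a b /groth_class_eq[c]; have [Nc [mc [hc ->]]] := @mvn_class_multiplicity R G q q1 d dP G_ GE c.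
  have [aN aE] := hm a; have [bN bE] := hm b.
  rewrite /psi !multiplicity_classD// => /multiplicity_classP[x|x|n E]; rewrite ?leq_add//.
  rewrite aE bE; apply/multiplicity_classP => //; exists n => x.
  by have := E x; rewrite !coset_sumD => /addIn.
- move=> u; have [a [b ->]] := groth_classB u.
  by have [a' <-] := psi_surj a; have [b' <-] := psi_surj b; exists a', b'.
- apply/seteqP; split=> [_ [u _ <-]|_ [e _ <-]].
    by exists (repr (psi u)) => //; rewrite /K0_class reprK.
  by have [u uE] := psi_surj (\pi_(mvn_class (roe q1 dP)) e)%qT; exists u; rewrite // uE.
- rewrite [RHS]/(groth_class _); congr groth_class.
  by rewrite (multiplicity_class1 q1 dP GE); apply: psiP => //; exact: multiplicity_class1.
Qed.

End main.

Theorem theorem4p10 (R : realType) (G : groupType)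
    (G_countable : countable [set: G]) (G_locally_finite : locally_finite G)
    (d : G -> G -> R) (dP : proper_left_invariant_metric d) :
  (infinite_set [set: G] ->
   forall (G_ : nat -> set G) (GE : finite_exhaustion G_) (p : R) (p1 : 1 <= p),
     triple_iso (K0_triple (roe p1 dP)) (linf_triple GE))
  /\
  (forall (p q : R) (p1 : 1 <= p) (q1 : 1 <= q),
     triple_iso (K0_triple (roe p1 dP)) (K0_triple (roe q1 dP))).
Proof.
split=> [G_infinite G_ GE p p1|p q p1 q1]; first exact: K0_roe_linf.
have [G_ GE] := finite_exhaustion_exists G_countable G_locally_finite.
exact: (K0_roe_exponent dP GE).
Qed.
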